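(* Let $\lambda=(\lambda_1,\dots,\lambda_m)$ be a partition of $n$. The complexification $V_{\mathbb{C}}(\lambda)$ of the real algebraic variety $V_{\mathbb{R}}(\lambda)\subset\mathbb{R}^{n(n+1)/2}$ of $n\times n$ real symmetric matrices with eigenvalue multiplicities corresponding to $\lambda$ or to partitions of $n$ coarser than $\lambda$ is an irreducible variety of dimension $$m+\binom{n}{2}-\sum_{i=1}^m\binom{\lambda_i}{2}.$$
   Context: A partition $\lambda=(\lambda_1,\dots,\lambda_m)$ of $n$ is a weakly decreasing sequence of positive integers with sum $n$. A partition of $n$ is coarser than $\lambda$ if it is obtained from $\lambda$ by merging (summing) parts. Identify the space of real symmetric $n\times n$ matrices with $\mathbb{R}^{n(n+1)/2}$. The variety of $\lambda$-partitioned eigenvalues $V_{\mathbb{R}}(\lambda)\subset\mathbb{R}^{n(n+1)/2}$ is the Zariski closure of the set of real symmetric $n\times n$ matrices having exactly $m$ distinct eigenvalues, with multiplicities $\lambda_1,\dots,\lambda_m$; because of the closure, it includes the matrices whose eigenvalue multiplicities are given by coarser partitions. Its complexification $V_{\mathbb{C}}(\lambda)\subset\mathbb{C}^{n(n+1)/2}$ is the Zariski closure of $V_{\mathbb{R}}(\lambda)$ in the space of complex symmetric $n\times n$ matrices, i.e. the complex zero set of the ideal of all real polynomials vanishing on $V_{\mathbb{R}}(\lambda)$. The convention is $\binom{1}{2}=0$. *)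

(* Defs.v *)
From mathcomp Require Import all_boot all_order all_algebra.
From mathcomp Require Import classical_sets reals.
From mathcomp Require Import complex.
From mathcomp Require Import mpoly.

Set Implicit Arguments.
Unset Strict Implicit.
Unset Printing Implicit Defensive.

Import Order.TTheory GRing.Theory Num.Theory.
Local Open Scope ring_scope.
Local Open Scope classical_set_scope.

Section Zariski.
Variables (K : fieldType) (N : nat).
Implicit Types (S Z V : set 'rV[K]_N) (P : set {mpoly K[N]}).

Definition peval (p : {mpoly K[N]}) (x : 'rV[K]_N) : K :=
  p.@[fun i => x ord0 i].

Definition zeros P : set 'rV[K]_N :=
  [set x | forall p, P p -> peval p x = 0].

Definition vanishing S : set {mpoly K[N]} :=
  [set p | forall x, S x -> peval p x = 0].

Definition zariski_closed Z : Prop := exists P, Z = zeros P.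

Definition zariski_closure S : set 'rV[K]_N := zeros (vanishing S).

(* Closed and irreducible for the Zariski topology; the empty set is not
   irreducible. *)
Definition irreducible_variety V : Prop :=
  [/\ zariski_closed V, V !=set0 &
      forall Z1 Z2, zariski_closed Z1 -> zariski_closed Z2 ->
        V `<=` Z1 `|` Z2 -> V `<=` Z1 \/ V `<=` Z2].

(* A chain F 0 < F 1 < ... < F d of irreducible closed subsets of V; the values
   F i with d < i are irrelevant. *)
Definition irreducible_chain V (d : nat) (F : nat -> set 'rV[K]_N) : Prop :=
  (forall i, (i <= d)%N -> irreducible_variety (F i) /\ F i `<=` V) /\
  (forall i, (i < d)%N -> F i `<` F i.+1).

(* Krull dimension of the Zariski topology on V. The members of a chain are
   closed in the whole affine space, so V is meant to be closed here. *)
Definition has_dimension V (d : nat) : Prop :=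
  (exists F, irreducible_chain V d F) /\
  (forall e F, irreducible_chain V e F -> (e <= d)%N).

End Zariski.

Lemma map_mpoly_scaleXD (K L : fieldType) (f : {rmorphism K -> L}) N a m
    (p : {mpoly K[N]}) :
  map_mpoly f (a *: 'X_[m] + p) = f a *: 'X_[m] + map_mpoly f p.
Proof. by rewrite rmorphD /= map_mpolyZ map_mpolyX. Qed.

Lemma peval_linear (K : fieldType) N (c : K) (p q : {mpoly K[N]}) x :
  peval (c *: p + q) x = c * peval p x + peval q x.
Proof. by rewrite /peval mevalD mevalZ. Qed.

Lemma peval_map (K L : fieldType) (f : {rmorphism K -> L}) N
    (p : {mpoly K[N]}) (x : 'rV[K]_N) :
  peval (map_mpoly f p) (map_mx f x) = f (peval p x).
Proof.
elim/mpolyind: p => [|c m p _ _ IH].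
  by rewrite raddf0 /peval !meval0 rmorph0.
rewrite map_mpoly_scaleXD !peval_linear IH rmorphD rmorphM; congr (_ * _ + _).
rewrite /peval !mevalX rmorph_prod.
by apply: eq_bigr => i _; rewrite mxE rmorphXn.
Qed.

Lemma map_mpoly_split (K L : fieldType) (f : {rmorphism K -> L}) (c : L)
    (u v : L -> K) N (p : {mpoly L[N]}) :
  (forall z, z = f (u z) + c * f (v z)) ->
  exists q r, p = c *: map_mpoly f q + map_mpoly f r.
Proof.
move=> hz; elim/mpolyind: p => [|a m p _ _ [q [r ->]]].
  exists 0, 0; rewrite (raddf0 (map_mpoly f)) scaler0 addr0 //.
exists (v a *: 'X_[m] + q), (u a *: 'X_[m] + r).
rewrite !map_mpoly_scaleXD scalerDr scalerA addrACA -scalerDl.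
by rewrite [_ + f _]addrC -hz.
Qed.

Lemma zariski_closure_map (K L : fieldType) (f : {rmorphism K -> L}) (c : L)
    (u v : L -> K) N (V : set 'rV[K]_N) :
  (forall z, z = f (u z) + c * f (v z)) ->
  (forall a b, c * f a + f b = 0 -> a = 0 /\ b = 0) ->
  zariski_closure [set map_mx f x | x in V] =
  zeros [set map_mpoly f p | p in vanishing V].
Proof.
move=> fuv fI; apply/seteqP; split=> z hz.
  move=> _ [p hp <-]; apply: hz => _ [x Vx <-].
  by rewrite peval_map hp // rmorph0.
move=> p hp; have [q [r pE]] := map_mpoly_split p fuv.
have hqr x : V x -> peval q x = 0 /\ peval r x = 0.
  move=> Vx; apply: fI; rewrite -!peval_map -peval_linear -pE.
  by apply: hp; exists x.
have vq : vanishing V q by move=> x /hqr[].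
have vr : vanishing V r by move=> x /hqr[].
have zq : peval (map_mpoly f q) z = 0 by apply: hz; exists q.
have zr : peval (map_mpoly f r) z = 0 by apply: hz; exists r.
by rewrite pE peval_linear zq zr mulr0 addr0.
Qed.

Section Complexification.
Variables (R : realType) (N : nat).

Definition complexification (V : set 'rV[R]_N) : set 'rV[R[i]]_N :=
  zariski_closure [set map_mx (real_complex R) x | x in V].

Lemma complexificationE (V : set 'rV[R]_N) :
  complexification V =
  zeros [set map_mpoly (real_complex R) p | p in vanishing V].
Proof.
apply: (zariski_closure_map (f := real_complex R) V (@complexE R)) => a b.
by case; rewrite !mul0r !mul1r ?subr0 ?oppr0 ?add0r ?addr0 ?add0r => -> ->.
Qed.

End Complexification.

(* The entries on and above the diagonal are the coordinates on the space of
   symmetric matrices. *)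
Definition upper_pairs (n : nat) : {set 'I_n * 'I_n} :=
  [set p : 'I_n * 'I_n | (p.1 <= p.2)%N].

Definition sym_dim (n : nat) : nat := #|upper_pairs n|.

Lemma sym_dimE n : sym_dim n = (n * n.+1)./2.
Proof.
have -> : sym_dim n = \sum_(i < n) \sum_(j < n | (i <= j)%N) 1%N.
  by rewrite pair_big_dep sum1dep_card.
rewrite (exchange_big_dep xpredT) //= mulnC -[n in (_ * n)%N]/(n.+1.-1).
rewrite -bin2 -bin2_sum big_nat_recl // big_mkord add0n.
apply: eq_bigr => j _.
by rewrite (big_ord_narrow (ltn_ord j)) sum1_card card_ord.
Qed.

Definition sym_coord (K : fieldType) (n : nat) (A : 'M[K]_n) :
    'rV[K]_(sym_dim n) :=
  \row_k A (enum_val k).1 (enum_val k).2.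

Definition is_partition (n : nat) (lam : seq nat) : Prop :=
  [/\ sorted geq lam, all (fun l => 0 < l)%N lam & sumn lam = n].

Definition has_multiplicities (K : fieldType) (n : nat) (lam : seq nat)
    (A : 'M[K]_n) : Prop :=
  exists mu : 'I_(size lam) -> K,
    [/\ injective mu,
        forall a, eigenvalue A a <-> exists i, a = mu i &
        forall i, mup (mu i) (char_poly A) = nth 0%N lam i].

Definition VR (R : realType) (n : nat) (lam : seq nat) :
    set 'rV[R]_(sym_dim n) :=
  zariski_closure
    [set sym_coord A | A in
       [set A : 'M[R]_n | A^T = A /\ has_multiplicities lam A]].
Arguments VR : clear implicits.

Definition VC (R : realType) (n : nat) (lam : seq nat) :
    set 'rV[R[i]]_(sym_dim n) :=
  complexification (VR R n lam).
Arguments VC : clear implicits.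

(* Main.v *)
Require Import Defs.
From mathcomp Require Import all_boot all_order all_algebra perm.
From mathcomp Require Import boolp classical_sets reals.
From mathcomp Require Import complex.
From mathcomp Require Import mpoly zify.

(* Fix a function [b] sending each of the n columns to its block. A flag chart
   Z = 1 + L, with L strictly block lower triangular, and scalars mu_j determine
   the symmetric matrix acting as mu_j on the j-th step of the flag of column
   spans of Z, taken orthogonally to the previous step. Clearing the denominator,
   which can be absorbed into mu, gives a polynomial map from affine space of
   dimension d = m + #{(i, k) | b k < b i}, the claimed dimension. Over the reals
   its values at distinct mu have the multiplicities lambda; conversely a
   symmetric matrix with these multiplicities comes from the flag of an eigenbasis
   X, and the line joining X to 1 meets the flags admitting a chart in all but
   finitely many points. So the polynomials vanishing on the variety are those
   whose composition with the map is 0, which gives irreducibility.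

   A chain of irreducible closed sets of length e yields e polynomials that are
   algebraically independent on the variety, while d + 1 polynomials in d
   variables are dependent; so e <= d. A chain of length d is obtained by freeing
   the d coordinates one at a time around a point where the Jacobian matrix of d of
   the entries is diagonal and invertible: L = 0 and mu distinct. *)

Set Implicit Arguments.
Unset Strict Implicit.
Unset Printing Implicit Defensive.

Import Order.TTheory GRing.Theory Num.Theory.
Local Open Scope ring_scope.
Local Open Scope classical_set_scope.

(** * Polynomials in several variables *)

Section MpolyFacts.

Lemma muniX (R : comNzRingType) n (m : 'X_{1..n.+1}) :
  muni ('X_[m] : {mpoly R[n.+1]}) =
  'X_[[multinom m (widen_ord (leqnSn n) i) | i < n]] *: 'X^(m ord_max).
Proof.
rewrite muniE msuppX big_seq1 mcoeffX eqxx scale1r.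
by congr ('X_[_] *: _); apply/mnmP=> i; rewrite !mnmE; congr (m _); apply/val_inj.
Qed.

Lemma mmap_muni (R S : comNzRingType) (f : {rmorphism R -> S}) n
    (h : 'I_n.+1 -> S) (p : {mpoly R[n.+1]}) :
  mmap f h p =
  (map_poly (mmap f (h \o widen_ord (leqnSn n))) (muni p)).[h ord_max].
Proof.
elim/mpolyind: p => [|c m p _ _ IH].
  by rewrite mmap0 muni0 rmorph0 horner0.
rewrite mmapD mmapZ mmapX muniD muniZ muniX !rmorphD /= hornerD -IH.
congr (_ + _); rewrite !map_polyZ !hornerZ map_polyXn hornerXn /= mmapC.
rewrite mmapX /mmap1 big_ord_recr /=; congr (_ * (_ * _)).
by apply: eq_bigr => i _; rewrite mnmE.
Qed.

Lemma meval_muni (R : comNzRingType) n (v : 'I_n.+1 -> R) (p : {mpoly R[n.+1]}) :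
  p.@[v] = (map_poly (meval (v \o widen_ord (leqnSn n))) (muni p)).[v ord_max].
Proof. exact: mmap_muni. Qed.

Lemma muni_eq0 (R : comNzRingType) n (p : {mpoly R[n.+1]}) :
  (muni p == 0) = (p == 0).
Proof.
apply/eqP/eqP=> [p0|->]; last exact: muni0.
rewrite -[p]comp_mpoly_id /comp_mpoly mmap_muni p0.
by rewrite rmorph0 horner0.
Qed.

Lemma poly_nat_roots (L : numDomainType) (p : {poly L}) :
  (forall k : nat, p.[k%:R] = 0) -> p = 0.
Proof.
move=> hp; apply/eqP; case: eqP => // /eqP p0.
have := max_poly_roots p0 (rs := [seq k%:R | k <- iota 0 (size p)]).
rewrite size_map size_iota ltnn; apply.
  by apply/allP=> _ /mapP[k _ ->]; apply/rootP.
rewrite map_inj_uniq ?iota_uniq // => i j /eqP.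
by rewrite eqr_nat => /eqP.
Qed.

(** Points with natural coordinates are Zariski dense, by induction on the number of variables.
    Since they are real, so are the real points in complex affine space. *)
Lemma mpoly_nat_zeros (L : numDomainType) n (p : {mpoly L[n]}) :
  (forall v : 'I_n -> nat, p.@[fun i => (v i)%:R] = 0) -> p = 0.
Proof.
elim: n p => [|n IH] p hp.
  by have := hp (fun=> 0%N); rewrite -[p]mpolyKC mevalC => ->; exact: mpolyC0.
apply/eqP; rewrite -muni_eq0; apply/eqP/polyP=> j; rewrite coef0.
apply: IH => v.
have: map_poly (meval (fun i => (v i)%:R)) (muni p) = 0.
  apply: poly_nat_roots => k.
  have := hp (fun i => if unlift ord_max i is Some i' then v i' else k).
  rewrite meval_muni /= unlift_none => <-; congr (_.[_]).
  apply: eq_map_poly => q; apply: meval_eq => i /=.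
  have -> : widen_ord (leqnSn n) i = lift ord_max i.
    by apply/val_inj; rewrite /= /bump leqNgt ltn_ord.
  by rewrite liftK.
by move/(congr1 (fun q : {poly L} => q`_j)); rewrite coef_map coef0.
Qed.

End MpolyFacts.

(** * Algebraic independence from a Jacobian determinant *)

Section JacobianCriterion.
Variable L : numFieldType.

Lemma mderivXU n (i a : 'I_n) : ('X_i : {mpoly L[n]})^`M(a) = (i == a)%:R.
Proof.
rewrite mderivX mnm1E; case: eqP => [->|_]; last by rewrite scale0r.
rewrite scale1r -mpolyX0; congr 'X_[_].
by apply/mnmP => j; rewrite mnmBE mnm0E subnn.
Qed.

(** The chain rule. The property [C] is stable under products and linear combinations, so only the
    variables need checking. *)
Lemma mderiv_comp n d (g : n.-tuple {mpoly L[d]}) a (p : {mpoly L[n]}) :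
  (p \mPo g)^`M(a) = \sum_b (p^`M(b) \mPo g) * (tnth g b)^`M(a).
Proof.
pose C (p : {mpoly L[n]}) :=
  (p \mPo g)^`M(a) = \sum_b (p^`M(b) \mPo g) * (tnth g b)^`M(a).
have CM p1 p2 : C p1 -> C p2 -> C (p1 * p2).
  rewrite /C rmorphM mderivM => -> ->.
  rewrite mulr_suml mulr_sumr -big_split /=; apply: eq_bigr => b _.
  by rewrite mderivM rmorphD !rmorphM /= mulrDl mulrAC mulrA.
have C1 : C 1.
  rewrite /C rmorph1 -mpolyC1 mderivC big1 // => b _.
  by rewrite -mpolyC1 mderivC comp_mpoly0 mul0r.
have CX i : C 'X_i.
  rewrite /C comp_mpolyXU -tnth_nth (bigD1 i) //= big1 => [|b nbi].
    by rewrite mderivXU eqxx rmorph1 addr0 mul1r.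
  by rewrite mderivXU eq_sym (negbTE nbi) comp_mpoly0 mul0r.
have CXn i k : C ('X_i ^+ k).
  elim: k => [|k IH]; first by rewrite expr0.
    by rewrite exprS; apply: CM.
suff: C p by [].
elim/mpolyind: p => [|c m p _ _ IH].
  rewrite /C comp_mpoly0 mderiv0 big1 // => b _.
  by rewrite mderiv0 comp_mpoly0 mul0r.
have CXm : C 'X_[m] by rewrite mpolyXE_id; apply: big_ind => // i _.
rewrite /C comp_mpolyD comp_mpolyZ mderivD mderivZ IH CXm scaler_sumr -big_split.
apply: eq_bigr => b _.
by rewrite /= mderivD mderivZ comp_mpolyD comp_mpolyZ mulrDl scalerAl.
Qed.

Lemma msize_mderiv_lt n k (p : {mpoly L[n]}) b :
  (msize p <= k.+1 -> msize p^`M(b) <= k)%N.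
Proof.
move=> pk; rewrite msizeE; apply/bigmax_leqP_seq => m + _.
rewrite mcoeff_msupp mcoeff_deriv => hm.
have: (m + U_(b))%MM \in msupp p.
  by rewrite mcoeff_msupp; apply: contraNneq hm => ->; rewrite mul0rn.
by move/msize_mdeg_lt; rewrite mdegD mdeg1 addn1 => h; have := leq_trans h pk.
Qed.

Lemma mderiv_eq0_polyC n (p : {mpoly L[n]}) :
  (forall b, p^`M(b) = 0) -> p = (p@_0)%:MP.
Proof.
move=> dp; apply/mpolyP => m; rewrite mcoeffC.
have [->|m0] := eqVneq m 0%MM; first by rewrite mulr1.
rewrite mulr0; have [i mi] : exists i, m i != 0%N.
  apply/existsP; apply: contraNT m0; rewrite negb_exists => /forallP h.
  by apply/eqP/mnmP => i; rewrite mnm0E; apply/eqP; rewrite -[_ == _]negbK.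
have /mpolyP/(_ (m - U_(i))%MM) := dp i.
rewrite mcoeff_deriv mcoeff0 submK; last first.
  by apply/mnm_lepP => j; rewrite mnm1E; case: eqP => [<-|//]; rewrite lt0n.
by move/eqP; rewrite mulrn_eq0 /= => /eqP.
Qed.

(* A relation of minimal degree has derivatives that are again relations,
   because the generic Jacobian matrix is invertible. *)
Lemma jacobian_algindep e (g : e.-tuple {mpoly L[e]}) (p : {mpoly L[e]}) :
  \det (\matrix_(b, a) (tnth g b)^`M(a)) != 0 -> p \mPo g = 0 -> p = 0.
Proof.
set J := \matrix_(b, a) _ => J0; move: {2}(msize p) (leqnn (msize p)) => k.
elim: k p => [|k IH] p pk pg0; first by apply/eqP; rewrite -msize_poly_eq0 -leqn0.
have dp b : p^`M(b) = 0.
  apply: IH; first exact: msize_mderiv_lt.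
  (* Differentiating [p \mPo g = 0] puts [u] in the left kernel of [J]; the adjugate then gives
     [\det J *: u = 0]. *)
  pose u : 'rV_e := \row_b (p^`M(b) \mPo g).
  have uJ : u *m J = 0.
    apply/rowP => a; have := congr1 (mderiv a) pg0; rewrite mderiv_comp mderiv0.
    by move=> E; rewrite !mxE -[RHS]E; apply: eq_bigr => c _; rewrite !mxE.
  have : \det J *: u = 0.
    by rewrite -mul_mx_scalar -mul_mx_adj mulmxA uJ mul0mx.
  move/rowP/(_ b); rewrite !mxE => /eqP; rewrite mulf_eq0 (negbTE J0) /=.
  by move/eqP.
have pC := mderiv_eq0_polyC dp; rewrite pC comp_mpolyC in pg0.
by rewrite pC.
Qed.

End JacobianCriterion.

(** * Algebraic dependence of d + 1 polynomials in d variables *)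

Section AlgebraicDependence.

Section Degree.
Variables (K : idomainType) (d : nat).
Definition deg_le (k : nat) (p : {mpoly K[d]}) := (msize p <= k.+1)%N.

Lemma deg_leM k1 k2 p1 p2 :
  deg_le k1 p1 -> deg_le k2 p2 -> deg_le (k1 + k2) (p1 * p2).
Proof.
rewrite /deg_le => h1 h2.
have [->|p10] := eqVneq p1 0; first by rewrite mul0r msize0.
have [->|p20] := eqVneq p2 0; first by rewrite mulr0 msize0.
rewrite msizeM // -ltnS prednK ?addn_gt0 ?lt0n ?msize_poly_eq0 ?p10 //.
by rewrite -addnS -addSn; apply: leq_add.
Qed.

Lemma deg_leX k p i : deg_le k p -> deg_le (k * i) (p ^+ i).
Proof.
move=> pk; elim: i => [|i IH]; first by rewrite expr0 /deg_le msize1.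
by rewrite exprS mulnS; apply: deg_leM.
Qed.
End Degree.

(* Monomials of degree < D in each of the d + 1 variables outnumber the monomials
   that can occur in their images as soon as D is large. *)
Lemma algebraic_dependence (K : fieldType) d (g : d.+1.-tuple {mpoly K[d]}) :
  exists2 p : {mpoly K[d.+1]}, p != 0 & p \mPo g = 0.
Proof.
pose c := (\max_i msize (tnth g i)).+1.
(* As [D] exceeds [C ^ d], one has [(C * D) ^ d < D ^ d.+1]: there are fewer target monomials than
   source monomials. *)
pose C := (c * d.+1)%N; pose D := ((C ^ d).+1)%N.
pose S := {ffun 'I_d.+1 -> 'I_D}; pose T := {ffun 'I_d -> 'I_(C * D)}.
pose ms (s : S) : 'X_{1..d.+1} := [multinom (s i : nat) | i < d.+1].
pose mt (t : T) : 'X_{1..d} := [multinom (t i : nat) | i < d].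
have C0 : (0 < C)%N by rewrite muln_gt0.
have gc i : deg_le c (tnth g i).
  by rewrite /deg_le /c !leqW // leq_bigmax.
have card_lt : (#|{: T}| < #|{: S}|)%N.
  rewrite !card_ffun !card_ord expnMn expnS ltn_pmul2r // expn_gt0 //.
(* Row [s] holds the coefficients of the image of the monomial [s]; a nonzero vector in the left
   kernel is a relation. *)
pose M : 'M[K]_(#|{: S}|, #|{: T}|) :=
  \matrix_(s, t) ('X_[ms (enum_val s)] \mPo g)@_(mt (enum_val t)).
have : kermx M != 0.
  rewrite -mxrank_eq0 mxrank_ker subn_eq0 -ltnNge.
  exact: leq_ltn_trans (rank_leq_col _) card_lt.
case/rowV0Pn => u; rewrite sub_kermx => /eqP uM u0.
exists (\sum_s u 0 s *: 'X_[ms (enum_val s)]).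
  have [s us] := rV0Pn _ u0.
  apply: contraNneq us => /mpolyP/(_ (ms (enum_val s))).
  rewrite mcoeff0 raddf_sum (bigD1 s) //= mcoeffZ mcoeffX eqxx mulr1.
  rewrite big1 ?addr0 => [->//|s' ns].
  rewrite mcoeffZ mcoeffX; case: eqP => [/mnmP E|]; last by rewrite mulr0.
  case/eqP: ns; apply: enum_val_inj; apply/ffunP => i; apply/val_inj.
  by have := E i; rewrite !mnmE.
apply/mpolyP => m; rewrite mcoeff0 (raddf_sum (comp_mpoly g)) (raddf_sum (mcoeff m)) /=.
have [mC|] := boolP [forall i, m i < C * D]%N.
  pose t : T := [ffun i => Ordinal (forallP mC i)].
  have <- : mt t = m by apply/mnmP => i; rewrite mnmE ffunE.
  have /rowP/(_ (enum_rank t)) := uM; rewrite !mxE => E.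
  rewrite -[RHS]E; apply: eq_bigr => s _.
  by rewrite comp_mpolyZ mcoeffZ !mxE enum_rankK.
(* A monomial with an exponent at least [C * D] exceeds the bound [C * D.-1] on the degree of the
   images, so [M] misses no coefficient. *)
rewrite negb_forall; case/existsP => i; rewrite -leqNgt => mi.
apply: big1 => s _; rewrite comp_mpolyZ mcoeffZ.
have: deg_le (C * D.-1) ('X_[ms (enum_val s)] \mPo g).
  have -> : (C * D.-1 = \sum_(j < d.+1) c * D.-1)%N.
    by rewrite sum_nat_const card_ord mulnCA mulnA.
  rewrite comp_mpolyX; apply: (big_ind2 (fun p k => deg_le k p)).
  - by rewrite /deg_le msize1.
  - by move=> *; apply: deg_leM.
  move=> j _; apply: leq_trans (deg_leX _ (gc j)) _.
  by rewrite ltnS leq_mul2l mnmE -ltnS prednK // ltn_ord orbT.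
move=> hdeg; rewrite memN_msupp_eq0 ?mulr0 //.
apply: msize_mdeg_ge; apply: leq_trans hdeg _.
have: (m i <= mdeg m)%N by rewrite mdegE (bigD1 i) //= leq_addr.
by apply: leq_trans; apply: leq_trans mi; rewrite ltn_mul2l C0 /=.
Qed.

End AlgebraicDependence.

(** * Varieties parametrized by polynomial maps *)

Section ParametrizedVarieties.
Variable K : numFieldType.

Section Vanishing.
Variable N : nat.
Implicit Types (S V W : set 'rV[K]_N) (p q : {mpoly K[N]}).

Lemma vanishing_closure S p : vanishing (zariski_closure S) p <-> vanishing S p.
Proof.
split=> hp x; last by apply.
by move=> Sx; apply: hp => q; apply.
Qed.

Lemma zariski_closedE V : zariski_closed V -> zariski_closure V = V.
Proof.
move=> [P ->]; apply/seteqP; split=> x hx p Pp; last by apply: Pp.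
by apply: hx => y; apply.
Qed.

Lemma zariski_closure_sub S V :
  zariski_closed V -> S `<=` V -> zariski_closure S `<=` V.
Proof.
by move=> /zariski_closedE {2}<- SV x hx p hp; apply: hx => y /SV; apply: hp.
Qed.

Lemma sub_zariski_closure S : S `<=` zariski_closure S.
Proof. by move=> x Sx p; apply. Qed.

Lemma zariski_closure_closed S : zariski_closed (zariski_closure S).
Proof. by exists (vanishing S). Qed.

Lemma pevalM p q x : peval (p * q) x = peval p x * peval q x.
Proof. exact: mevalM. Qed.

Lemma not_sub_zeros V (P : set {mpoly K[N]}) :
  ~ V `<=` zeros P -> exists2 p, P p & ~ vanishing V p.
Proof.
move=> nVP; apply: contrapT => H; apply: nVP => x Vx p Pp.
by apply: contrapT => px; apply: H; exists p => // /(_ x Vx).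
Qed.

Lemma irreducible_vanishingM V p q : irreducible_variety V ->
  vanishing V (p * q) -> vanishing V p \/ vanishing V q.
Proof.
move=> [_ _ irr] hpq.
have [||x Vx|h|h] := irr (zeros [set p]) (zeros [set q]).
- by exists [set p].
- by exists [set q].
- have /eqP := hpq x Vx; rewrite pevalM mulf_eq0 => /orP[] /eqP E.
    by left=> _ ->.
  by right=> _ ->.
- by left=> x /h; apply.
- by right=> x /h; apply.
Qed.

Lemma irreducible_vanishingX V p k : irreducible_variety V ->
  vanishing V (p ^+ k) -> vanishing V p.
Proof.
move=> irrV; elim: k => [|k IH]; last first.
  by rewrite exprS => /(irreducible_vanishingM irrV)[|/IH].
case: irrV => _ [x Vx] _ /(_ x Vx).
by rewrite expr0 /peval meval1 => /eqP; rewrite oner_eq0.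
Qed.

Definition algindep_on V e (f : e.-tuple {mpoly K[N]}) : Prop :=
  forall P : {mpoly K[e]}, vanishing V (P \mPo f) -> P = 0.

(* A relation on W between f and h can be taken not divisible by the variable of
   h, W being irreducible; on V, where h = 0, it is then a relation between f. *)
Lemma algindep_on_rcons V W e (f : e.-tuple {mpoly K[N]}) h :
  irreducible_variety W -> V `<=` W -> vanishing V h -> ~ vanishing W h ->
  algindep_on V f -> algindep_on W [tuple of rcons f h].
Proof.
move=> irrW VW Vh Wh fV P WP; apply/eqP; apply: contrapT => /negP P0.
move: P0; rewrite -muni_eq0 => q0.
(* [q'] is left of [P], seen as a polynomial in its last variable, once the largest power of that
   variable is removed; so [q'] is nonzero at 0. *)
have [k [q' + qE]] := multiplicity_XsubC (muni P) 0; rewrite q0 /= => q'0.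
pose q'h := (map_poly (comp_mpoly f) q').[h].
have PE : P \mPo [tuple of rcons f h] = q'h * h ^+ k.
  rewrite [LHS]mmap_muni.
  have -> : tnth [tuple of rcons f h] ord_max = h.
    by rewrite (tnth_nth 0) /= nth_rcons size_tuple ltnn eqxx.
  have -> : map_poly (mmap (@mpolyC _ _)
       (tnth [tuple of rcons f h] \o widen_ord (leqnSn e))) (muni P) =
       map_poly (comp_mpoly f) (muni P).
    apply: eq_map_poly => p; apply: eq_bigr => m _; congr (_ * _).
    apply: mmap1_eq => i /=.
    by rewrite !(tnth_nth 0) /= nth_rcons size_tuple ltn_ord.
  rewrite qE subr0 rmorphM rmorphXn /= map_polyX hornerM hornerXn.
  by [].
rewrite PE in WP.
have [Wq'|/(irreducible_vanishingX irrW)//] := irreducible_vanishingM irrW WP.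
(* Since [h] is 0 on [V], there [q'h] restricts to [q'.[0]] composed with [f], so [q'.[0]] is a
   relation between the [f] and must be 0. *)
case/negP: q'0; apply/rootP; apply: fV => x Vx.
have := Wq' x (VW x Vx); rewrite /peval /q'h.
rewrite -horner_map /= [(h).@[_]](Vh x Vx) => E; rewrite -[RHS]E.
rewrite -[in RHS](rmorph0 (meval (fun i => x ord0 i))) horner_map /=; congr (_.@[_]).
by rewrite -[in RHS](rmorph0 (comp_mpoly f)) horner_map.
Qed.

(** Each strict inclusion provides a polynomial vanishing on [F i] but not on [F i.+1]; appending it
    keeps independence. *)
Lemma irreducible_chain_algindep V d (F : nat -> set 'rV[K]_N) :
  irreducible_chain V d F ->
  forall i, (i <= d)%N -> exists f : i.-tuple {mpoly K[N]}, algindep_on (F i) f.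
Proof.
move=> [Firr Flt]; elim=> [|i IH] id.
  exists [tuple] => P hP; have [[_ [x Fx] _] _] := Firr _ id.
  have := hP x Fx; rewrite [P]nvar0_mpolyC comp_mpolyC /peval mevalC => ->.
  exact: mpolyC0.
have [f fi] := IH (ltnW id); have [FiS nFiS] := Flt _ id.
have [irr _] := Firr _ id; have [[cl _ _] _] := Firr _ (ltnW id).
have [h hi hSi] : exists2 h, vanishing (F i) h & ~ vanishing (F i.+1) h.
  by apply: not_sub_zeros; rewrite -/(zariski_closure _) zariski_closedE.
by exists [tuple of rcons f h]; apply: algindep_on_rcons hi hSi fi.
Qed.

End Vanishing.

Definition pmap_point N d (g : N.-tuple {mpoly K[d]}) (v : 'I_d -> K) : 'rV[K]_N :=
  \row_i (tnth g i).@[v].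

(** The ideal of [V] is the kernel of substitution of [g], so [V] is the closure of the image. In
    this form primality and dimension are read off the polynomial ring in [d] variables. *)
Definition parametrized N d (g : N.-tuple {mpoly K[d]}) (V : set 'rV[K]_N) :=
  zariski_closed V /\ forall p, vanishing V p <-> p \mPo g = 0.

Definition comp_tuple N d e (f : N.-tuple {mpoly K[d]}) (g : d.-tuple {mpoly K[e]}) :
  N.-tuple {mpoly K[e]} := [tuple tnth f i \mPo g | i < N].

Section Parametrized.
Variables N d : nat.
Implicit Types (g : N.-tuple {mpoly K[d]}) (V : set 'rV[K]_N).

Lemma peval_pmap_point g v (p : {mpoly K[N]}) :
  peval p (pmap_point g v) = (p \mPo g).@[v].
Proof. by rewrite comp_mpoly_meval; apply: meval_eq => i; rewrite mxE. Qed.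

Lemma mpoly_zeros (p : {mpoly K[d]}) : (forall v, p.@[v] = 0) -> p = 0.
Proof. by move=> hp; apply: mpoly_nat_zeros => v. Qed.

Lemma comp_tupleE e (g : N.-tuple {mpoly K[d]}) (h : e.-tuple {mpoly K[N]})
    (p : {mpoly K[e]}) : (p \mPo h) \mPo g = p \mPo comp_tuple h g.
Proof.
apply/eqP; rewrite -subr_eq0; apply/eqP/mpoly_zeros => v.
rewrite mevalB !comp_mpoly_meval; apply/eqP; rewrite subr_eq0; apply/eqP.
by apply: meval_eq => i; rewrite tnth_mktuple comp_mpoly_meval.
Qed.

Lemma parametrized_point g V v : parametrized g V -> V (pmap_point g v).
Proof.
move=> [/zariski_closedE {2}<- gV] p /gV pg0.
by rewrite peval_pmap_point pg0 meval0.
Qed.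

Lemma parametrized_closure g (S : set ('I_d -> K)) :
  (forall p : {mpoly K[d]}, (forall v, S v -> p.@[v] = 0) -> p = 0) ->
  parametrized g (zariski_closure [set pmap_point g v | v in S]).
Proof.
move=> dense; split; first exact: zariski_closure_closed.
move=> p; split=> [/vanishing_closure hp|pg0].
  by apply: dense => v Sv; rewrite -peval_pmap_point; apply: hp; exists v.
by apply/vanishing_closure => _ [v _ <-]; rewrite peval_pmap_point pg0 meval0.
Qed.

(** The ideal of [V] is the kernel of a morphism into an integral domain, hence prime. *)
Lemma parametrized_irreducible g V : parametrized g V -> irreducible_variety V.
Proof.
move=> gV; have [Vcl Vg] := gV; split=> //.
  by exists (pmap_point g (fun=> 0)); apply: parametrized_point.
move=> _ _ [P1 ->] [P2 ->] V12; apply: contrapT => /not_orP[].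
move=> /not_sub_zeros[p1 P1p1 Vp1] /not_sub_zeros[p2 P2p2 Vp2].
have: (p1 * p2) \mPo g = 0.
  apply/Vg => x Vx; rewrite pevalM.
  by have [/(_ _ P1p1)->|/(_ _ P2p2)->] := V12 x Vx; rewrite ?mul0r ?mulr0.
by rewrite rmorphM => /eqP; rewrite mulf_eq0 => /orP[] /eqP /Vg.
Qed.

(** A longer chain would give [d.+1] polynomials independent on [F d.+1]; but their composites with
    [g] satisfy a relation, which then holds on all of [V]. *)
Lemma parametrized_chain_le g V e F :
  parametrized g V -> irreducible_chain V e F -> (e <= d)%N.
Proof.
move=> [_ gV] chainF; rewrite leqNgt; apply/negP => de.
have [f fF] := irreducible_chain_algindep chainF de.
have [P P0 Pg] := algebraic_dependence (comp_tuple f g).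
case/eqP: P0; apply: fF => x Fx; move: Pg; rewrite -comp_tupleE => /gV /(_ x); apply.
by have [/(_ _ de)[_ FV] _] := chainF; apply: FV.
Qed.

End Parametrized.

(** * Existence of a chain of full length *)

Section ChainExistence.
Variables (N d : nat) (g : N.-tuple {mpoly K[d]}) (V : set 'rV[K]_N).
Variables (s : 'I_d -> 'I_N) (y0 : 'I_d -> K) (c : 'I_d -> K).
Hypothesis gV : parametrized g V.
Hypothesis c0 : forall b, c b != 0.
Hypothesis jac : forall a b, ((tnth g (s b))^`M(a)).@[y0] = c b *+ (a == b).

(** The first [e] coordinates stay free and the others are frozen at those of [y0]; [F e] is the
    closure of the image of this slice. *)
Let freeze_coord e (k : 'I_d) : {mpoly K[e]} :=
  if (insub (k : nat) : option 'I_e) is Some j then 'X_j else (y0 k)%:MP.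

Let freeze e : d.-tuple {mpoly K[e]} := [tuple freeze_coord e k | k < d].

Let F i := zariski_closure [set pmap_point (comp_tuple g (freeze i)) v | v in setT].

Let freezeE i v k : (tnth (freeze i) k).@[v] =
  if (insub (k : nat) : option 'I_i) is Some j then v j else y0 k.
Proof.
by rewrite tnth_mktuple /freeze_coord; case: insub => [j|]; rewrite ?mevalXU ?mevalC.
Qed.

Let pmap_freeze i v : pmap_point (comp_tuple g (freeze i)) v =
  pmap_point g (fun k => (tnth (freeze i) k).@[v]).
Proof. by apply/rowP => j; rewrite !mxE tnth_mktuple comp_mpoly_meval. Qed.

Let F_param i : parametrized (comp_tuple g (freeze i)) (F i).
Proof. by apply: parametrized_closure => p hp; apply: mpoly_zeros => v; apply: hp. Qed.

Let F_subV i : F i `<=` V.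
Proof.
apply: zariski_closure_sub; first by case: gV.
by move=> _ [v _ <-]; rewrite pmap_freeze; apply: parametrized_point.
Qed.

Let F_incr i : (i < d)%N -> F i `<=` F i.+1.
Proof.
move=> id; apply: zariski_closure_sub; first exact: zariski_closure_closed.
move=> _ [v _ <-]; apply: sub_zariski_closure.
exists (fun k => (tnth (freeze i) (widen_ord id k)).@[v]) => //.
rewrite !pmap_freeze; congr pmap_point; apply/funext => k; rewrite freezeE.
case: insubP => [k1 _ Ek1|nk].
  by congr (_.@[_]); congr tnth; apply/val_inj.
by rewrite freezeE insubN //; apply: contra nk; apply: leqW.
Qed.

(** The [i.+1] coordinates [s (w b)] are dependent on [F i], which has only [i] parameters, but
    independent on [F i.+1] by the Jacobian criterion, the determinant being nonzero at [y0]. *)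
Let F_strict i : (i < d)%N -> ~ F i.+1 `<=` F i.
Proof.
move=> id FS; pose w (b : 'I_i.+1) := widen_ord id b.
pose gam e := [tuple tnth g (s (w b)) \mPo freeze e | b < i.+1].
have [P P0 Pg] := algebraic_dependence (gam i).
pose sel := [tuple 'X_(s (w b)) : {mpoly K[N]} | b < i.+1].
have PE e : (P \mPo sel) \mPo comp_tuple g (freeze e) = P \mPo gam e.
  rewrite comp_tupleE; congr (_ \mPo _); apply: eq_from_tnth => b.
  by rewrite !tnth_mktuple comp_mpolyXU -tnth_nth tnth_mktuple.
case/eqP: P0; apply: (@jacobian_algindep _ _ (gam i.+1)).
  apply: contraTneq (oner_neq0 K) => /(congr1 (meval (y0 \o w))).
  rewrite meval0 -det_map_mx.
  have -> : map_mx (meval (y0 \o w))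
      (\matrix_(b, a) (tnth (gam i.+1) b)^`M(a)) = diag_mx (\row_b c (w b)).
    apply/matrixP => b a; rewrite !mxE tnth_mktuple mderiv_comp rmorph_sum /=.
    have fr k : (tnth (freeze i.+1) k).@[y0 \o w] = y0 k.
      by rewrite freezeE; case: insubP => //= j _ E; congr y0; apply/val_inj.
    have dfr k : (tnth (freeze i.+1) k)^`M(a) = (w a == k)%:R.
      rewrite tnth_mktuple /freeze_coord; case: insubP => [j _ Ej|nk].
        by rewrite mderivXU eq_sym -!val_eqE /= Ej.
      rewrite mderivC; case: eqP => // E.
      by case/negP: nk; rewrite -E /= ltn_ord.
    rewrite (bigD1 (w a)) //= big1 => [|k nk]; rewrite mevalM dfr.
      rewrite comp_mpoly_meval (meval_eq _ fr) jac eqxx meval1 mulr1 addr0.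
      by rewrite eq_sym -val_eqE.
    by rewrite eq_sym (negbTE nk) meval0 mulr0.
  rewrite det_diag => /eqP; rewrite prodf_seq_eq0 => /hasP[b _].
  by rewrite mxE (negbTE (c0 _)).
have [[_ Fi] [_ FiS]] := (F_param i, F_param i.+1).
by rewrite -PE; apply/FiS => x /FS; move: x; apply/Fi; rewrite PE.
Qed.

Lemma parametrized_chain : exists F, irreducible_chain V d F.
Proof.
exists F; split=> i id; last by split; [apply: F_incr|apply: F_strict].
by split; [apply: parametrized_irreducible (F_param i)|apply: F_subV].
Qed.

End ChainExistence.
End ParametrizedVarieties.

(** * Symmetric matrices attached to flags *)

Lemma mxtrace_tr_mul_ge0 (F : realDomainType) p q (M : 'M[F]_(p, q)) :
  0 <= \tr (M *m M^T).
Proof.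
apply: sumr_ge0 => i _; rewrite mxE; apply: sumr_ge0 => j _.
by rewrite mxE -expr2 sqr_ge0.
Qed.

Lemma mxtrace_tr_mul_eq0 (F : realDomainType) p q (M : 'M[F]_(p, q)) :
  \tr (M *m M^T) = 0 -> M = 0.
Proof.
move=> trM; apply/matrixP => i j; rewrite mxE.
have sq k l : 0 <= M k l * M^T l k by rewrite mxE -expr2 sqr_ge0.
have row_ge0 k : true -> 0 <= (M *m M^T) k k by rewrite mxE sumr_ge0.
move/psumr_eq0P: trM => /(_ row_ge0 i isT); rewrite mxE.
move/psumr_eq0P => /(_ (fun l _ => sq i l) j isT).
by rewrite mxE => /eqP; rewrite mulf_eq0 orbb => /eqP.
Qed.

Section FlagMatrices.
Variables (n m : nat) (b : 'I_n -> 'I_m).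

Section Definitions.
Variable A : comNzRingType.
Implicit Types (X : 'M[A]_n) (mu : 'I_m -> A).

Definition trunc_mx (j : nat) : 'M[A]_n := diag_mx (\row_k (b k < j)%N%:R).
Local Notation E := trunc_mx.

(** The Gram matrix of the columns in the first [j] blocks, padded by an identity block so that its
    size does not depend on [j]. *)
Definition flag_gram X j := E j *m X^T *m X *m E j + (1%:M - E j).

Definition flag_denom X := \prod_(j < m.+1) \det (flag_gram X j).

(** For invertible [X], [flag_denom X] times the orthogonal projection onto the j-th step of the
    flag. The adjugate and the omitted j-th factor keep it polynomial. *)
Definition flag_num X j :=
  (\prod_(i < m.+1 | i != j :> nat) \det (flag_gram X i)) *:
    (X *m E j *m \adj (flag_gram X j) *m E j *m X^T).

(* [flag_denom X] times the symmetric matrix acting as [mu j] on the orthogonal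
   complement of the j-th step in the (j+1)-st step of the flag spanned by the
   blocks of columns of [X]. *)
Definition flag_mx X mu : 'M[A]_n :=
  \sum_(j < m) mu j *: (flag_num X j.+1 - flag_num X j).

Definition block_minor X j := E j *m X *m E j + (1%:M - E j).

Definition block_diag mu : 'M[A]_n := diag_mx (\row_k mu (b k)).

Lemma trunc_mxE j i k : E j i k = ((b k < j)%N && (i == k))%:R.
Proof.
rewrite !mxE; case: eqP => [->|_]; first by rewrite mulr1n andbT.
by rewrite mulr0n andbF.
Qed.

Lemma tr_trunc_mx j : (E j)^T = E j.
Proof. exact: tr_diag_mx. Qed.

Lemma trunc_mxM i j : (i <= j)%N -> E i *m E j = E i.
Proof.
move=> ij; rewrite mulmx_diag; congr diag_mx; apply/rowP => k; rewrite !mxE.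
by case: (ltnP (b k) i) => h; rewrite ?mul0r // (leq_trans h ij) mulr1.
Qed.

Lemma trunc_mxMl i j : (i <= j)%N -> E j *m E i = E i.
Proof. by move=> ij; rewrite diag_mxC trunc_mxM. Qed.

Lemma trunc_mx0 : E 0 = 0.
Proof. by apply/matrixP => i k; rewrite trunc_mxE mxE ltn0. Qed.

Lemma trunc_mx_full : E m = 1%:M.
Proof. by apply/matrixP => i k; rewrite trunc_mxE mxE ltn_ord. Qed.

Lemma tr_flag_gram X j : (flag_gram X j)^T = flag_gram X j.
Proof.
by rewrite /flag_gram linearD linearB /= !trmx_mul !trmxK tr_trunc_mx trmx1 !mulmxA.
Qed.

Lemma flag_gram_truncr X j : flag_gram X j *m E j = E j *m X^T *m X *m E j.
Proof. by rewrite mulmxDl mulmxBl -!mulmxA !trunc_mxM // mul1mx subrr addr0. Qed.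

End Definitions.

Local Notation E := (trunc_mx _).

Section Functoriality.
Variables (A B : comNzRingType) (f : {rmorphism A -> B}).

Lemma map_trunc_mx j : map_mx f (trunc_mx A j) = trunc_mx B j.
Proof. by apply/matrixP => i k; rewrite mxE !trunc_mxE rmorph_nat. Qed.

Lemma map_flag_gram (X : 'M[A]_n) j :
  map_mx f (flag_gram X j) = flag_gram (map_mx f X) j.
Proof.
by rewrite /flag_gram map_mxD map_mxB map_mx1 !map_mxM /= !map_trunc_mx map_trmx.
Qed.

Lemma map_block_minor (X : 'M[A]_n) j :
  map_mx f (block_minor X j) = block_minor (map_mx f X) j.
Proof. by rewrite map_mxD map_mxB map_mx1 !map_mxM /= map_trunc_mx. Qed.

Lemma map_flag_num (X : 'M[A]_n) j :
  map_mx f (flag_num X j) = flag_num (map_mx f X) j.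
Proof.
rewrite /flag_num map_mxZ rmorph_prod !map_mxM /= map_mx_adj map_flag_gram.
rewrite map_trunc_mx map_trmx; congr (_ *: _).
by apply: eq_bigr => i _; rewrite -det_map_mx map_flag_gram.
Qed.

(** The construction is polynomial, so it commutes with evaluation of the entries and with the
    embedding of the reals in the complex numbers. *)
Lemma map_flag_mx (X : 'M[A]_n) mu :
  map_mx f (flag_mx X mu) = flag_mx (map_mx f X) (f \o mu).
Proof.
rewrite /flag_mx raddf_sum; apply: eq_bigr => j _.
by rewrite /= map_mxZ map_mxB !map_flag_num.
Qed.

End Functoriality.

Section FlagProjections.
Variable F : realFieldType.
Local Notation E := (trunc_mx F).
Implicit Types (X Z : 'M[F]_n) (mu : 'I_m -> F).

(** For [v] in the left kernel, [v *m flag_gram X j *m v^T] is 0; it is the sum of the squared norms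
    of [v *m E j *m X^T] and [w], so both vanish. *)
Lemma flag_gram_unit X j : X \in unitmx -> flag_gram X j \in unitmx.
Proof.
move=> Xu; rewrite -row_free_unit -kermx_eq0; apply/rowV0P => v.
rewrite sub_kermx => /eqP vG; set w := v *m (1%:M - E j).
have idem : (1%:M - E j) *m (1%:M - E j)^T = 1%:M - E j.
  rewrite linearB /= trmx1 tr_trunc_mx mulmxBl mul1mx mulmxBr mulmx1.
  by rewrite trunc_mxM // subrr subr0.
have wE : w *m w^T = v *m (1%:M - E j) *m v^T.
  by rewrite /w trmx_mul !mulmxA -(mulmxA v) idem.
have vE : v *m E j *m X^T *m (v *m E j *m X^T)^T + w *m w^T =
    v *m flag_gram X j *m v^T.
  rewrite wE /flag_gram !trmx_mul trmxK tr_trunc_mx.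
  by rewrite [in RHS]mulmxDr [in RHS]mulmxDl !mulmxA.
have : \tr (v *m E j *m X^T *m (v *m E j *m X^T)^T) + \tr (w *m w^T) = 0.
  by rewrite -raddfD /= vE vG mul0mx mxtrace0.
move=> /eqP; rewrite paddr_eq0 ?mxtrace_tr_mul_ge0 // => /andP[/eqP + /eqP].
move=> /mxtrace_tr_mul_eq0 vEX /mxtrace_tr_mul_eq0.
rewrite /w mulmxBr mulmx1 => /eqP; rewrite subr_eq0 => /eqP ->.
by apply: (can_inj (mulmxK (_ : X^T \in unitmx))); rewrite ?unitmx_tr // vEX mul0mx.
Qed.

Definition flag_proj X j := X *m E j *m invmx (flag_gram X j) *m E j *m X^T.

Lemma flag_denom_neq0 X : X \in unitmx -> flag_denom X != 0.
Proof.
move=> Xu; apply/prodf_neq0 => j _.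
by have := flag_gram_unit j Xu; rewrite unitmxE unitfE.
Qed.

Lemma flag_numE X j : X \in unitmx -> (j < m.+1)%N ->
  flag_num X j = flag_denom X *: flag_proj X j.
Proof.
move=> Xu jm; rewrite /flag_num /flag_denom.
rewrite [in RHS](bigD1 (Ordinal jm)) //= [in RHS]mulrC.
rewrite /flag_proj /invmx flag_gram_unit // -!scalemxAr -!scalemxAl scalerA.
by rewrite mulfK // -unitfE -unitmxE flag_gram_unit.
Qed.

Lemma tr_flag_proj X j : (flag_proj X j)^T = flag_proj X j.
Proof.
by rewrite /flag_proj !trmx_mul !trmxK trmx_inv tr_flag_gram tr_trunc_mx !mulmxA.
Qed.

Lemma flag_projE X j : X \in unitmx -> flag_proj X j *m (X *m E j) = X *m E j.
Proof.
move=> Xu.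
have -> : flag_proj X j *m (X *m E j) =
    X *m E j *m invmx (flag_gram X j) *m (E j *m X^T *m X *m E j).
  by rewrite /flag_proj !mulmxA.
by rewrite -flag_gram_truncr !mulmxA mulmxKV ?flag_gram_unit // -mulmxA trunc_mxM.
Qed.

Lemma flag_proj_mulr X i j : X \in unitmx -> (i <= j)%N ->
  flag_proj X j *m flag_proj X i = flag_proj X i.
Proof.
move=> Xu ij; rewrite {2 3}/flag_proj -(trunc_mxMl F ij) !mulmxA.
by rewrite -(mulmxA _ X) flag_projE.
Qed.

Lemma flag_proj_mull X i j : X \in unitmx -> (i <= j)%N ->
  flag_proj X i *m flag_proj X j = flag_proj X i.
Proof.
move=> Xu ij; apply: trmx_inj.
by rewrite trmx_mul !tr_flag_proj flag_proj_mulr.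
Qed.

Lemma flag_proj0 X : flag_proj X 0 = 0.
Proof. by rewrite /flag_proj trunc_mx0 mulmx0 !mul0mx. Qed.

Lemma flag_proj_full X : X \in unitmx -> flag_proj X m = 1%:M.
Proof.
move=> Xu; have := flag_projE m Xu; rewrite trunc_mx_full mulmx1 => E1.
by apply: (can_inj (mulmxK Xu)); rewrite E1 mul1mx.
Qed.

Lemma mxtrace_flag_proj X j : X \in unitmx -> \tr (flag_proj X j) = \tr (E j).
Proof.
move=> Xu.
have -> : flag_proj X j = X *m E j *m (invmx (flag_gram X j) *m (E j *m X^T)).
  by rewrite /flag_proj !mulmxA.
have gramE : E j *m X^T *m (X *m E j) = E j *m X^T *m X *m E j by rewrite !mulmxA.
rewrite mxtrace_mulC -mulmxA gramE.
by rewrite -flag_gram_truncr mulKmx ?flag_gram_unit.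
Qed.

(** The projection depends only on the span. The inclusion of spans gives [P *m Q = Q] and
    [Q *m P = Q], so the squared norm of [P - Q] is the difference of the two traces, which
    agree. *)
Lemma flag_proj_uniq X Z j W : X \in unitmx -> Z \in unitmx ->
  Z *m E j = X *m E j *m W -> flag_proj Z j = flag_proj X j.
Proof.
move=> Xu Zu ZX; set P := flag_proj X j; set Q := flag_proj Z j.
have PQ : P *m Q = Q.
  have -> : Q = X *m E j *m (W *m (invmx (flag_gram Z j) *m E j *m Z^T)).
    by rewrite /Q {1}/flag_proj ZX -!mulmxA.
  by rewrite mulmxA (flag_projE j Xu).
have QP : Q *m P = Q by apply: trmx_inj; rewrite trmx_mul !tr_flag_proj PQ.
apply/eqP; rewrite eq_sym -subr_eq0; apply/eqP/mxtrace_tr_mul_eq0.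
rewrite linearB /= !tr_flag_proj -/P -/Q mulmxBl !mulmxBr PQ QP.
rewrite !flag_proj_mull // subrr subr0 raddfB /= !mxtrace_flag_proj //.
by rewrite subrr.
Qed.

Lemma flag_mxE X mu : X \in unitmx ->
  flag_mx X mu = \sum_(j < m)
    (flag_denom X * mu j) *: (flag_proj X j.+1 - flag_proj X j).
Proof.
move=> Xu; apply: eq_bigr => j _.
by rewrite !flag_numE // ?ltnS ?(ltnW (ltn_ord j)) // -scalerBr scalerA mulrC.
Qed.

Lemma sum_flag_proj X : X \in unitmx ->
  \sum_(j < m) (flag_proj X j.+1 - flag_proj X j) = 1%:M.
Proof.
move=> Xu; rewrite -(big_mkord xpredT (fun j => flag_proj X j.+1 - flag_proj X j)).
by rewrite telescope_sumr // flag_proj_full // flag_proj0 subr0.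
Qed.

Lemma tr_flag_mx X mu : X \in unitmx -> (flag_mx X mu)^T = flag_mx X mu.
Proof.
move=> Xu; rewrite flag_mxE // linear_sum; apply: eq_bigr => j _.
by rewrite /= linearZ linearB /= !tr_flag_proj.
Qed.

End FlagProjections.
End FlagMatrices.

(** * Diagonalization of symmetric matrices *)

Section SymmetricDiagonalization.

Lemma dvdp_prod_XsubC_mup (F : fieldType) (rs : seq F) (p : {poly F}) :
  p != 0 -> (forall x, (count_mem x rs <= mup x p)%N) ->
  \prod_(x <- rs) ('X - x%:P) %| p.
Proof.
elim: rs p => [|x rs IH] p p0 hc; first by rewrite big_nil dvd1p.
have : 'X - x%:P %| p.
  by rewrite XsubC_dvd //; apply: leq_trans (hc x); rewrite /= eqxx.
case/dvdpP => q pE.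
have q0 : q != 0 by apply: contraNneq p0; rewrite pE => ->; rewrite mul0r.
rewrite pE big_cons mulrC dvdp_mul2r ?polyXsubC_eq0 //; apply: IH => // y.
have := hc y; rewrite pE mupM ?polyXsubC_eq0 // (mup_XsubCX 1) /= eq_sym addnC.
by case: (y == x) => /=; rewrite ?addn1 ?addn0 ?add1n ?add0n ?ltnS.
Qed.

Lemma char_poly_similar (F : fieldType) n (A B X : 'M[F]_n) :
  X \in unitmx -> A *m X = X *m B -> char_poly A = char_poly B.
Proof.
move=> Xu AX; pose Y := map_mx polyC X.
have detY : \det Y != 0.
  by rewrite det_map_mx polyC_eq0 -unitfE -unitmxE.
apply: (mulIf detY); rewrite /char_poly [RHS]mulrC -!det_mulmx; congr (\det _).
by rewrite mulmxBl mulmxBr -!map_mxM AX scalar_mxC.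
Qed.

Lemma tr_horner_mx (R : comNzRingType) n' (A : 'M[R]_n'.+1) (p : {poly R}) :
  (horner_mx A p)^T = horner_mx A^T p.
Proof.
elim/poly_ind: p => [|p c IH]; first by rewrite !rmorph0 trmx0.
rewrite !rmorphD !rmorphM /= !horner_mx_X !horner_mx_C linearD /= tr_scalar_mx.
congr (_ + _); rewrite -!mulmxE trmx_mul IH.
have AA : comm_mx A^T A^T by [].
exact: (comm_mx_horner p AA).
Qed.

(** [N ^+ k.+1] is symmetric and its square is 0 as soon as [N ^+ k.+2] is, so its norm vanishes and
    the exponent drops by one. *)
Lemma symmetric_nilpotent_eq0 (F : realDomainType) n' (N : 'M[F]_n'.+1) k :
  N^T = N -> N ^+ k.+1 = 0 -> N = 0.
Proof.
move=> Ns; elim: k => [|k IH] Nk; first by rewrite -[N]expr1.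
apply: IH; apply: mxtrace_tr_mul_eq0.
have -> : (N ^+ k.+1)^T = N ^+ k.+1.
  elim: k.+1 => [|l IHl]; first by rewrite !expr0 trmx1.
  by rewrite {1}exprS -mulmxE trmx_mul IHl Ns mulmxE -exprSr.
rewrite mulmxE -exprD addSnnS addnC exprD Nk.
by rewrite mul0r mxtrace0.
Qed.

(** With [q] the product over the distinct roots, [horner_mx A q] is symmetric, and nilpotent by
    Cayley-Hamilton, hence 0: the minimal polynomial has simple roots. *)
Lemma symmetric_diagonalizable (F : realFieldType) n' (A : 'M[F]_n'.+1) (rs : seq F) :
  A^T = A -> char_poly A = \prod_(x <- rs) ('X - x%:P) -> diagonalizable A.
Proof.
move=> As cA; apply/diagonalizableP; exists (undup rs); first exact: undup_uniq.
apply: mxminpoly_min; set q := \prod_(x <- _) _.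
apply: (@symmetric_nilpotent_eq0 _ _ _ (size rs)).
  by rewrite tr_horner_mx As.
rewrite -rmorphXn /=.
suff /dvdpP[r ->] : char_poly A %| q ^+ (size rs).+1.
  by rewrite rmorphM /= Cayley_Hamilton mulr0.
rewrite cA; apply: (@dvdp_trans _ (q ^+ size rs)); last by rewrite exprSr dvdp_mulr.
have : {subset rs <= undup rs} by move=> x; rewrite mem_undup.
rewrite {}/q; move: (undup rs) => us; elim: rs {cA} => [|x rs IH] sub.
  by rewrite big_nil dvd1p.
rewrite big_cons exprS dvdp_mul //; last first.
  by apply: IH => y yrs; apply: sub; rewrite inE yrs orbT.
have xus : x \in us by apply: sub; rewrite inE eqxx.
by rewrite (big_rem x) //= dvdp_mulr.
Qed.

(** The eigenvalues come in the prescribed order [d], which later puts the eigenvectors of one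
    eigenvalue into one block. *)
Lemma symmetric_eigenbasis (F : realFieldType) n (A : 'M[F]_n) (d : 'I_n -> F) :
  A^T = A -> char_poly A = \prod_k ('X - (d k)%:P) ->
  exists2 X : 'M[F]_n, X \in unitmx & A *m X = X *m diag_mx (\row_k d k).
Proof.
case: n A d => [|n'] A d As cA.
  by exists 1%:M; [exact: unitmx1 | apply/matrixP => -[]].
have dE : [tuple d k | k < n'.+1] = codom d :> seq F by rewrite /= codomE.
have cA' : char_poly A = \prod_(x <- [tuple d k | k < n'.+1]) ('X - x%:P).
  by rewrite cA big_tuple; apply: eq_bigr => k _; rewrite tnth_mktuple.
have [P Pu /diagonalizable_forPex[D /(simmxP Pu) PA]] :=
  symmetric_diagonalizable As cA'.
have AP : A *m P^T = P^T *m diag_mx D.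
  by apply: trmx_inj; rewrite !trmx_mul trmxK As PA tr_diag_mx.
have charD : char_poly A = \prod_k ('X - (D 0 k)%:P).
  have -> : \prod_k ('X - (D 0 k)%:P) = char_poly (diag_mx D).
    rewrite char_poly_trig ?diag_mx_is_trig //.
    by apply: eq_bigr => k _; rewrite mxE eqxx.
  by apply: char_poly_similar AP; rewrite unitmx_tr.
have perm : perm_eq [tuple d k | k < n'.+1] [tuple D 0 k | k < n'.+1].
  apply: prod_XsubC_eq; rewrite -cA' charD big_tuple.
  by apply: eq_bigr => k _; rewrite tnth_mktuple.
have /tuple_permP[s sE] := perm.
have {sE} ds k : d k = D 0 (s k).
  have := congr1 (fun t => nth 0 t k) sE.
  by rewrite -!tnth_nth !tnth_mktuple.
exists (col_perm s P^T).
  by rewrite col_permE unitmx_mul unitmx_tr Pu unitmx_perm.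
apply/matrixP => i k; have /matrixP/(_ i (s k)) := AP.
rewrite !mul_mx_diag !mxE ds => <-.
by apply: eq_bigr => j _; rewrite !mxE.
Qed.

End SymmetricDiagonalization.

(** * Eigenvalues of the matrix of a flag *)

Section FlagEigen.
Variables (F : realFieldType) (n m : nat) (b : 'I_n -> 'I_m).
Hypothesis b_mono : forall i k : 'I_n, (i <= k)%N -> (b i <= b k)%N.
Local Notation E := (trunc_mx b F).
Local Notation P := (flag_proj b).
Implicit Types (A X Z : 'M[F]_n) (mu : 'I_m -> F).

Lemma unitriangular_unit Z :
  (forall i k, (b i <= b k)%N -> Z i k = (i == k)%:R) -> Z \in unitmx.
Proof.
move=> Zu; have Zt : is_trig_mx Z.
  apply/is_trig_mxP => i k ik; rewrite Zu ?b_mono ?(ltnW ik) //.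
  by rewrite -val_eqE ltn_eqF.
rewrite unitmxE det_trig // big1 ?unitr1 // => i _.
by rewrite Zu ?eqxx.
Qed.

(** Each step of the flag is stable under [A], so by symmetry its projection commutes with [A].
    Moreover [A - (mu j)%:M] maps step j + 1 into step j, hence kills the orthogonal complement of
    step j in step j + 1. *)
Lemma symmetric_flag_proj_sum A X mu : X \in unitmx -> A^T = A ->
  A *m X = X *m block_diag b mu ->
  A = \sum_(j < m) mu j *: (P X j.+1 - P X j).
Proof.
move=> Xu As AX.
have PAP j : P X j *m (A *m P X j) = A *m P X j.
  have -> : A *m P X j = X *m E j *m
      (block_diag b mu *m (invmx (flag_gram b X j) *m E j *m X^T)).
    rewrite [in LHS]/flag_proj !mulmxA AX -!(mulmxA X).
    by rewrite [block_diag b mu *m _]diag_mxC.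
  by rewrite mulmxA (flag_projE b j Xu).
have comm j : P X j *m A = A *m P X j.
  have trAP : (A *m P X j)^T = P X j *m A by rewrite trmx_mul As tr_flag_proj.
  by rewrite -{1}trAP -PAP trmx_mul trAP tr_flag_proj -mulmxA PAP.
have eig (j : 'I_m) : (A - (mu j)%:M) *m (P X j.+1 - P X j) = 0.
  (* Block [j] of this difference is 0, so cutting off after it or before it is the same. *)
  have DE : (block_diag b mu - (mu j)%:M) *m E j.+1 =
      E j *m (block_diag b mu - (mu j)%:M).
    apply/matrixP => i k; rewrite mul_mx_diag mul_diag_mx !mxE ltnS.
    case: eqP => [->|_]; last by rewrite !mulr0n subrr mul0r mulr0.
    rewrite !mulr1n leq_eqVlt val_eqE.
    case: eqP => [->|_] /=; first by rewrite subrr mul0r mulr0.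
    by rewrite mulrC.
  have fix_j : P X j *m ((A - (mu j)%:M) *m P X j.+1) = (A - (mu j)%:M) *m P X j.+1.
    have -> : (A - (mu j)%:M) *m P X j.+1 = X *m E j *m
        ((block_diag b mu - (mu j)%:M) *m
         (invmx (flag_gram b X j.+1) *m E j.+1 *m X^T)).
      have -> : (A - (mu j)%:M) *m P X j.+1 = (A - (mu j)%:M) *m X *m E j.+1 *m
         (invmx (flag_gram b X j.+1) *m E j.+1 *m X^T).
        by rewrite /flag_proj !mulmxA.
      have -> : (A - (mu j)%:M) *m X = X *m (block_diag b mu - (mu j)%:M).
        by rewrite mulmxBl mulmxBr AX scalar_mxC.
      by rewrite -(mulmxA X) DE !mulmxA.
    by rewrite mulmxA (flag_projE b j Xu).
  rewrite mulmxBr -fix_j (mulmxA (P X j)) (mulmxBr (P X j)) comm scalar_mxC.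
  rewrite -mulmxBl -mulmxA.
  by rewrite flag_proj_mull // subrr.
rewrite -[LHS]mulmx1 -(sum_flag_proj b Xu) mulmx_sumr; apply: eq_bigr => j _.
by apply/eqP; rewrite -subr_eq0 -mul_scalar_mx -mulmxBl eig.
Qed.

Lemma symmetric_flag_mx A X mu : X \in unitmx -> A^T = A ->
  A *m X = X *m block_diag b mu ->
  A = flag_mx b X (fun j => mu j / flag_denom b X).
Proof.
move=> Xu As /(symmetric_flag_proj_sum Xu As) ->.
rewrite flag_mxE //; apply: eq_bigr => j _.
by rewrite mulrC divfK // flag_denom_neq0.
Qed.

(** Conjugation by [X] turns the projections into the [N j], which agree with [E j] on and below the
    diagonal blocks; so [T] is upper triangular with the eigenvalues on its diagonal. *)
Lemma char_poly_flag_mx X mu : X \in unitmx ->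
  char_poly (flag_mx b X mu) =
  \prod_k ('X - (flag_denom b X * mu (b k))%:P).
Proof.
move=> Xu; pose N j := invmx X *m P X j *m X.
pose T := \sum_(j < m) (flag_denom b X * mu j) *: (N j.+1 - N j).
have AX : flag_mx b X mu *m X = X *m T.
  rewrite flag_mxE // mulmx_suml mulmx_sumr; apply: eq_bigr => j _.
  rewrite -scalemxAl -scalemxAr; congr (_ *: _).
  by rewrite mulmxBl mulmxBr /N !mulmxA mulmxV // !mul1mx.
have NE j i k : (b k <= b i)%N -> N j i k = ((b k < j)%N && (i == k))%:R.
  move=> ki; have [ij|ij] := ltnP (b i) j.
    have kj : (b k < j)%N := leq_ltn_trans ki ij.
    have -> : N j i k = (N j *m E j) i k.
      by rewrite mul_mx_diag !mxE kj mulr1.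
    rewrite /N -(mulmxA _ X) -(mulmxA (invmx X)) (flag_projE b j Xu).
    by rewrite mulKmx // trunc_mxE kj.
  have -> : N j i k = (E j *m N j) i k.
    have NX : N j = E j *m (invmx (flag_gram b X j) *m E j *m X^T *m X).
      by rewrite /N /flag_proj !mulmxA mulVmx // mul1mx.
    by rewrite NX mulmxA trunc_mxM.
  rewrite mul_diag_mx !mxE ltnNge ij mul0r; case: eqP => [ik|]; last by rewrite andbF.
  by rewrite -ik ltnNge ij.
rewrite (char_poly_similar Xu AX) /char_poly -det_tr.
have -> : (char_poly_mx T)^T = char_poly_mx T^T.
  by rewrite /char_poly_mx linearB /= tr_scalar_mx map_trmx.
have TE i k : (b k <= b i)%N -> T i k = (flag_denom b X * mu (b k)) *+ (i == k).
  have scE c (M1 M2 : 'M[F]_n) : (c *: (M1 - M2)) i k = c * (M1 i k - M2 i k).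
    by rewrite !mxE.
  move=> ki; rewrite summxE (bigD1 (b k)) //= big1 => [|j jk].
    rewrite scE !NE // ltnS leqnn ltnn /= subr0 addr0.
    by case: eqP; rewrite ?mulr1 ?mulr0.
  rewrite scE !NE // ltnS leq_eqVlt val_eqE eq_sym (negbTE jk) /=.
  by rewrite subrr mulr0.
rewrite -/(char_poly _) char_poly_trig.
  by apply: eq_bigr => k _; rewrite mxE TE // eqxx.
apply/is_trig_mxP => i k ik; rewrite mxE TE ?b_mono ?(ltnW ik) //.
by rewrite -val_eqE gtn_eqF.
Qed.

(* The block LU decomposition, with [S] the projection onto the span of the first
   columns of [X] parallel to the last coordinate vectors. *)
Lemma flag_chart X : (forall j, (j <= m)%N -> block_minor b X j \in unitmx) ->
  exists2 Z : 'M[F]_n, forall i k, (b i <= b k)%N -> Z i k = (i == k)%:R &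
    forall j, exists W, Z *m E j = X *m E j *m W.
Proof.
move=> Hu; pose H := block_minor b X.
pose S j := X *m (E j *m invmx (H j) *m E j).
have ES j : (j <= m)%N -> E j *m S j = E j.
  move=> jm; have -> : E j *m S j = E j *m X *m E j *m invmx (H j) *m E j.
    by rewrite /S !mulmxA.
  have -> : E j *m X *m E j = E j *m H j.
    by rewrite mulmxDr mulmxBr !mulmxA !trunc_mxM // mulmx1 subrr addr0.
  by rewrite mulmxK ?Hu // trunc_mxM.
(* Each column comes from the projection [S] of its own block, which makes the diagonal blocks
   identities and the blocks above them 0. *)
pose Z := \matrix_(i, k) S (b k).+1 i k.
have ZE i k : Z i k = S (b k).+1 i k by rewrite mxE.
exists Z => [i k ik|j].
  have -> : Z i k = (E (b k).+1 *m S (b k).+1) i k.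
    by rewrite ZE mul_diag_mx mxE [(\row_ _ _) _ _]mxE ltnS ik mul1r.
  by rewrite ES ?ltn_ord // trunc_mxE ltnS leqnn.
pose V k := E (b k).+1 *m invmx (H (b k).+1) *m E (b k).+1.
pose W := \matrix_(l, k) if (b k < j)%N then V k l k else 0.
have WE l k : W l k = if (b k < j)%N then V k l k else 0 by rewrite mxE.
exists W; apply/matrixP => i k.
rewrite mul_mx_diag mxE [(\row_ _ _) _ _]mxE ZE [RHS]mxE.
under eq_bigr do rewrite WE.
have [kj|kj] := boolP (b k < j)%N; last first.
  by rewrite mulr0 big1 // => l _; rewrite mulr0.
have XV : X *m V k = X *m E j *m V k.
  by rewrite /V !mulmxA -(mulmxA X (E j)) trunc_mxMl.
by rewrite mulr1 /S -/(V k) XV mxE.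
Qed.

Lemma flag_mx_chart X mu : X \in unitmx ->
  (forall j, (j <= m)%N -> block_minor b X j \in unitmx) ->
  exists Z mu', (forall i k, (b i <= b k)%N -> Z i k = (i == k)%:R) /\
    flag_mx b X mu = flag_mx b Z mu'.
Proof.
move=> Xu /flag_chart[Z Z1 ZX]; have Zu := unitriangular_unit Z1.
(* The flags coincide; the new scalars make up for the change of denominator. *)
exists Z, (fun j => flag_denom b X * mu j / flag_denom b Z); split=> //.
rewrite !flag_mxE //; apply: eq_bigr => j _.
rewrite [flag_denom b Z * _]mulrC divfK ?flag_denom_neq0 //.
have [W WE] := ZX j; have [W' WE'] := ZX j.+1.
by rewrite (flag_proj_uniq Xu Zu WE) (flag_proj_uniq Xu Zu WE').
Qed.

End FlagEigen.

(** * Blocks and parameters *)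

Section BlockFunction.
Variables (n : nat) (lam : seq nat).
Hypothesis lamn : sumn lam = n.

Fact block_of_subproof (k : 'I_n) : (reshape_index lam k < size lam)%N.
Proof. by apply: reshape_indexP; rewrite lamn. Qed.

Definition block_of (k : 'I_n) : 'I_(size lam) := Ordinal (block_of_subproof k).

Lemma block_of_mono (i k : 'I_n) : (i <= k)%N -> (block_of i <= block_of k)%N.
Proof.
rewrite (reshape_leq lam) => /orP[/ltnW //|/andP[/eqP h _]].
by rewrite /= h.
Qed.

Lemma card_block_of j : #|[pred k | block_of k == j]| = nth 0%N lam j.
Proof.
have fP (c : 'I_(nth 0%N lam j)) : (flatten_index lam j c < n)%N.
  by rewrite -lamn; apply: flatten_indexP.
rewrite -[RHS]card_ord -(card_imset predT (f := fun c => Ordinal (fP c))).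
  apply: eq_card => k; rewrite !inE; apply/eqP/imsetP => [kj|[c _ ->]].
    have klam : (k < sumn lam)%N by rewrite lamn.
    have := reshape_offsetP klam; rewrite -[reshape_index _ _]/(val (block_of k)) kj.
    move=> h; exists (Ordinal h) => //; apply/val_inj => /=.
    by rewrite -[LHS](reshape_indexK lam) -kj.
  by apply/val_inj; rewrite /= flatten_indexKl.
move=> c1 c2 /(congr1 val) /= /(congr1 (reshape_offset lam)).
by rewrite !flatten_indexKr // => /val_inj.
Qed.

Lemma block_of_surj : all (fun l => 0 < l)%N lam -> forall j, exists k, block_of k = j.
Proof.
move=> /allP pos j; have : (0 < #|[pred k | block_of k == j]|)%N.
  by rewrite card_block_of; apply: pos; rewrite mem_nth.
by case/card_gt0P => k /eqP; exists k.
Qed.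

End BlockFunction.

Section ChartParameters.
Local Open Scope nat_scope.
Variables (n m : nat) (b : 'I_n -> 'I_m).

(* [inl j] stands for the eigenvalue of block [j], [inr (i, k)] for the free entry
   (i, k) of the chart. *)
Definition is_param (p : 'I_m + 'I_n * 'I_n) : bool :=
  if p is inr (i, k) then (b k < b i)%N else true.

Definition param := {p | is_param p}.

Definition mu_param (j : 'I_m) : param := exist _ (inl j) isT.

Lemma bin2_square k : (k * k = 'C(k, 2).*2 + k)%N.
Proof.
elim: k => // k IH; rewrite binS bin1; lia.
Qed.

(** Comparing the blocks of the two indices splits the [n * n] pairs into two classes of size [lt]
    and, for each block [j], [c j * c j] pairs within it. *)
Lemma card_param : #|{: param}| =
  (m + 'C(n, 2) - \sum_(j < m) 'C(#|[pred k | b k == j]|, 2))%N.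
Proof.
pose lt := \sum_(p : 'I_n * 'I_n) (b p.2 < b p.1)%N.
have -> : #|{: param}| = (m + lt)%N.
  rewrite card_sig -sum1_card big_sumType /=; congr (_ + _)%N.
    by rewrite sum1_card card_ord.
  rewrite /lt big_mkcond; apply: eq_bigr => -[i k] _.
  by rewrite inE /=; case: (b k < b i)%N.
have gt : lt = \sum_(p : 'I_n * 'I_n) (b p.1 < b p.2)%N.
  rewrite /lt (reindex (fun p : 'I_n * 'I_n => (p.2, p.1))) //.
  by exists (fun p : 'I_n * 'I_n => (p.2, p.1)) => -[].
pose c j := #|[pred k | b k == j]|.
have eq : \sum_(p : 'I_n * 'I_n) (b p.2 == b p.1) = \sum_(j < m) c j * c j.
  rewrite -(pair_bigA _ (fun i k => (b k == b i) : nat)) /=.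
  rewrite (partition_big b predT) //=; apply: eq_bigr => j _.
  rewrite -[X in (X * _)%N]sum1_card big_distrl /=.
  apply: eq_big => [i|i /eqP bi]; first by rewrite inE.
  rewrite mul1n /c -sum1_card [in RHS]big_mkcond /= bi.
  by apply: eq_bigr => k _; rewrite inE; case: eqP.
have all_pairs : (lt + lt + \sum_(j < m) c j * c j = n * n)%N.
  rewrite -eq {2}gt -!big_split /= -[n in RHS]card_ord -card_prod -sum1_card.
  by apply: eq_bigr => p _; rewrite -val_eqE /=; case: ltngtP.
have sum_n : \sum_(j < m) c j = n.
  rewrite -[RHS]card_ord -sum1_card (partition_big b predT) //=.
  by apply: eq_bigr => j _; rewrite /c -sum1_card; apply: eq_bigl => k; rewrite inE.
(* This equality also ensures that the subtraction is not truncated. *)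
suff <- : (lt + \sum_(j < m) 'C(c j, 2) = 'C(n, 2))%N by rewrite addnA addnK.
have dbl : \sum_(j < m) c j * c j = ((\sum_(j < m) 'C(c j, 2)).*2 + n)%N.
  rewrite -[in RHS]sum_n -mul2n big_distrr -big_split /=.
  by apply: eq_bigr => j _; rewrite bin2_square mul2n.
by have := bin2_square n; lia.
Qed.

End ChartParameters.

(** * Multiplicities and density of the chart *)

Section Multiplicities.
Variables (F : realFieldType) (n : nat) (lam : seq nat).
Hypothesis lamn : sumn lam = n.
Hypothesis lam_pos : all (fun l => 0 < l)%N lam.
Local Notation b := (block_of lamn).
Implicit Types (A X : 'M[F]_n) (mu : 'I_(size lam) -> F).

Lemma prod_XsubC_image (f : 'I_n -> F) :
  \prod_k ('X - (f k)%:P) = \prod_(x <- [seq f k | k <- enum 'I_n]) ('X - x%:P).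
Proof. by rewrite big_map big_enum. Qed.

Lemma count_block mu j : injective mu ->
  count_mem (mu j) [seq mu (b k) | k <- enum 'I_n] = nth 0%N lam j.
Proof.
move=> inj_mu; rewrite -(card_block_of lamn) cardE -size_filter.
rewrite [in RHS]/enum_mem -enumT filter_map size_map.
congr (size _); apply: eq_filter => k /=.
by rewrite !inE (inj_eq inj_mu).
Qed.

Lemma has_multiplicities_flag_mx X mu : X \in unitmx -> injective mu ->
  has_multiplicities lam (flag_mx b X mu).
Proof.
move=> Xu inj_mu; have D0 := flag_denom_neq0 b Xu.
pose nu j := flag_denom b X * mu j.
have inj_nu : injective nu by move=> i j /(mulfI D0) /inj_mu.
have charE : char_poly (flag_mx b X mu) =
    \prod_(x <- [seq nu (b k) | k <- enum 'I_n]) ('X - x%:P).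
  by rewrite (char_poly_flag_mx (block_of_mono lamn)) // -prod_XsubC_image.
exists nu; split=> // [a|j]; last by rewrite charE mu_prod_XsubC count_block.
rewrite eigenvalue_root_char charE root_prod_XsubC.
split=> [/mapP[k _ ->]|[j ->]]; first by exists (b k).
have [k <-] := block_of_surj lamn lam_pos j.
by apply/mapP; exists k; rewrite ?mem_enum.
Qed.

(** The multiplicities add up to [n], so the product of linear factors that divides the
    characteristic polynomial has full degree, and the latter splits over [F]. *)
Lemma symmetric_has_multiplicities A : A^T = A -> has_multiplicities lam A ->
  exists2 X, X \in unitmx & exists mu, A = flag_mx b X mu.
Proof.
move=> As [mu [inj_mu _ mupA]].
have charE : char_poly A = \prod_k ('X - (mu (b k))%:P).
  rewrite prod_XsubC_image; apply/esym/eqP.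
  rewrite -eqp_monic ?monic_prod_XsubC ?char_poly_monic //.
  rewrite -dvdp_size_eqp; last first.
    apply: dvdp_prod_XsubC_mup => [|x]; first by rewrite monic_neq0 ?char_poly_monic.
    have [/mapP[k _ ->]|nx] := boolP (x \in [seq mu (b k) | k <- enum 'I_n]).
      by rewrite count_block // mupA.
    by rewrite (count_memPn nx).
  by rewrite size_char_poly size_prod_XsubC size_map size_enum_ord.
have [X Xu AX] := symmetric_eigenbasis As charE.
by exists X => //; eexists; apply: symmetric_flag_mx Xu As AX.
Qed.

End Multiplicities.

Section Density.
Variables (F : realFieldType) (n m : nat) (b : 'I_n -> 'I_m).
Hypothesis b_mono : forall i k : 'I_n, (i <= k)%N -> (b i <= b k)%N.

Lemma horner_mmap N (h : 'I_N -> {poly F}) (p : {mpoly F[N]}) t :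
  (mmap polyC h p).[t] = p.@[fun i => (h i).[t]].
Proof.
elim/mpolyind: p => [|c m' p _ _ IH]; first by rewrite mmap0 meval0 horner0.
rewrite mmapD mmapZ mmapX hornerD hornerM hornerC IH mevalD mevalZ mevalX.
rewrite /mmap1 horner_prod; congr (_ * _ + _).
by apply: eq_bigr => i _; rewrite horner_exp.
Qed.

(* Join [X] to the identity by a line; all but finitely many of its points have
   invertible leading block minors. *)
Lemma chart_dense (p : {mpoly F[sym_dim n]}) :
  (forall (Z : 'M[F]_n) mu, (forall i k, (b i <= b k)%N -> Z i k = (i == k)%:R) ->
     peval p (sym_coord (flag_mx b Z mu)) = 0) ->
  forall (X : 'M[F]_n) mu, X \in unitmx -> peval p (sym_coord (flag_mx b X mu)) = 0.
Proof.
move=> chart0 X mu Xu.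
pose Xt : 'M[{poly F}]_n := map_mx polyC X + 'X *: map_mx polyC (1%:M - X).
pose Xat t := X + t *: (1%:M - X).
have XtE t : map_mx (horner_eval t) Xt = Xat t.
  by apply/matrixP => i k; rewrite !mxE /horner_eval !hornerE.
pose At := flag_mx b Xt (polyC \o mu).
have AtE t : map_mx (horner_eval t) At = flag_mx b (Xat t) mu.
  rewrite map_flag_mx XtE; apply: eq_bigr => j _ /=.
  by rewrite /horner_eval hornerC.
pose q := mmap polyC (fun k : 'I_(sym_dim n) => At (enum_val k).1 (enum_val k).2) p.
have qE t : q.[t] = peval p (sym_coord (flag_mx b (Xat t) mu)).
  rewrite horner_mmap -AtE; apply: meval_eq => k.
  by rewrite !mxE.
pose w := \det Xt * \prod_(j < m.+1) \det (block_minor b Xt j).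
have wE t : w.[t] = \det (Xat t) * \prod_(j < m.+1) \det (block_minor b (Xat t) j).
  rewrite hornerM horner_prod -!/(horner_eval t _) -det_map_mx XtE.
  congr (_ * _); apply: eq_bigr => j _.
  by rewrite -/(horner_eval t _) -det_map_mx map_block_minor XtE.
(* At [t = 1] the line reaches the identity, where all these determinants are 1. *)
have w0 : w != 0.
  apply: contra_eq_neq (wE 1) => /= ->; rewrite horner0 /Xat scale1r addrC subrK.
  rewrite det1 mul1r big1 ?oner_neq0 1?eq_sym ?oner_neq0 // => j _.
  by rewrite /block_minor mulmx1 trunc_mxM // addrC subrK det1.
have wq : w * q = 0.
  apply: poly_nat_roots => k; rewrite hornerM; set t := k%:R.
  have [->|] := eqVneq w.[t] 0; first by rewrite mul0r.
  rewrite wE mulf_eq0 negb_or => /andP[Xt0 /prodf_neq0 minors].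
  rewrite qE; have [|j jm|Z [nu [Z1 ->]]] := @flag_mx_chart _ _ _ b b_mono (Xat t) mu.
  - by rewrite unitmxE unitfE.
  - by rewrite unitmxE unitfE; apply: (minors (Ordinal (jm : (j < m.+1)%N))).
  by rewrite chart0 ?mulr0.
have q0 : q = 0 by apply/eqP; move/eqP: wq; rewrite mulf_eq0 (negbTE w0).
have := qE 0; rewrite q0 horner0 /Xat scale0r addr0 => E; exact: esym E.
Qed.

End Density.

(** * The derivative at the identity *)

Section FlagDerivative.
Variables (n m : nat) (b : 'I_n -> 'I_m).
Variables (A K : comNzRingType) (ev : {rmorphism A -> K}) (D : {additive A -> K}).
(** [D] is a derivation at the point [ev]; it will be a partial derivative evaluated at the base
    point. *)
Hypothesis DM : forall x y, D (x * y) = D x * ev y + ev x * D y.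
Local Notation E := (trunc_mx b _).

Lemma derivation1 : D 1 = 0.
Proof.
have := DM 1 1; rewrite mulr1 rmorph1 mulr1 mul1r => /eqP.
by rewrite eq_sym -subr_eq0 addrK => /eqP.
Qed.

Lemma derivation_nat k : D k%:R = 0.
Proof. by rewrite raddfMn derivation1 mul0rn. Qed.

Lemma derivation_mulmx p q r (M : 'M[A]_(p, q)) (N : 'M[A]_(q, r)) :
  map_mx D (M *m N) = map_mx D M *m map_mx ev N + map_mx ev M *m map_mx D N.
Proof.
apply/matrixP => i k; rewrite !mxE raddf_sum -big_split /=; apply: eq_bigr => j _.
by rewrite DM !mxE.
Qed.

Lemma derivation_scalemx p q (c : A) (M : 'M[A]_(p, q)) :
  map_mx D (c *: M) = D c *: map_mx ev M + ev c *: map_mx D M.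
Proof. by apply/matrixP => i k; rewrite !mxE DM. Qed.

Lemma derivation_trunc_mx j : map_mx D (E j) = 0.
Proof. by apply/matrixP => i k; rewrite mxE trunc_mxE derivation_nat mxE. Qed.

Lemma derivation_scalar_mx (c : A) : D c = 0 -> map_mx D (c%:M : 'M_n) = 0.
Proof. by move=> Dc; apply/matrixP => i k; rewrite !mxE raddfMn Dc mul0rn. Qed.

Lemma derivation_prod1 (I : Type) (r : seq I) (Q : pred I) (f : I -> A) :
  (forall i, Q i -> ev (f i) = 1) ->
  ev (\prod_(i <- r | Q i) f i) = 1 /\
  D (\prod_(i <- r | Q i) f i) = \sum_(i <- r | Q i) D (f i).
Proof.
move=> f1; apply: (big_ind2 (fun x d => ev x = 1 /\ D x = d)).
- by rewrite rmorph1 derivation1.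
- move=> x1 d1 x2 d2 [e1 <-] [e2 <-].
  by rewrite rmorphM DM e1 e2 !mulr1 mul1r.
- by move=> i /f1.
Qed.

(* Jacobi's formula at the identity *)
Lemma derivation_det (G : 'M[A]_n) :
  map_mx ev G = 1%:M -> D (\det G) = \tr (map_mx D G).
Proof.
move=> G1; have evG i k : ev (G i k) = (i == k)%:R.
  by have /matrixP/(_ i k) := G1; rewrite !mxE.
rewrite /determinant raddf_sum (bigD1 (1%g : 'S_n)) //=.
(* A permutation other than the identity moves some [i], hence also [s i]; its product then has two
   factors killed by [ev], so its derivative is 0. *)
rewrite [X in _ + X]big1 => [|s s1]; last first.
  have [i si] : exists i, s i != i.
    apply/existsP; apply: contraNT s1; rewrite negb_exists => /forallP h.
    by apply/eqP/permP => i; rewrite perm1; apply/eqP; rewrite -[_ == _]negbK.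
  rewrite (bigD1 i) //= (bigD1 (s i)) //= DM (DM (G i (s i))) !rmorphM !evG.
  rewrite [i == s i]eq_sym (negbTE si) (inj_eq perm_inj) eq_sym (negbTE si).
  by rewrite !(mul0r, mulr0, addr0).
rewrite odd_perm1 expr0 mul1r addr0.
have [|_ ->] := @derivation_prod1 _ (index_enum 'I_n) xpredT
  (fun i => G i ((1%g : 'S_n) i)).
  by move=> i _; rewrite perm1 evG eqxx.
by apply: eq_bigr => i _; rewrite perm1 mxE.
Qed.

Variables (X : 'M[A]_n) (mu : 'I_m -> A).
Hypothesis X1 : map_mx ev X = 1%:M.
Let T := map_mx D X.
Hypothesis T_low : forall i k : 'I_n, (b i <= b k)%N -> T i k = 0.

Let ev_gram j : map_mx ev (flag_gram b X j) = 1%:M.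
Proof.
rewrite map_flag_gram X1 /flag_gram trmx1 !mulmx1 trunc_mxM //.
by rewrite addrC subrK.
Qed.

Let D_gram j : map_mx D (flag_gram b X j) = E j *m (T + T^T) *m E j.
Proof.
rewrite /flag_gram map_mxD map_mxB !derivation_mulmx !derivation_trunc_mx.
rewrite derivation_scalar_mx ?derivation1 // subr0 !map_mxM /= !map_trunc_mx.
rewrite -!map_trmx X1 trmx1 -/T !mul0mx !mulmx0 !mulmx1 !add0r addr0 addr0.
by rewrite [T + _]addrC mulmxDr.
Qed.

(** [T] is 0 on the diagonal, so by Jacobi's formula these determinants are constant to first
    order. *)
Let D_det_gram j : D (\det (flag_gram b X j)) = 0.
Proof.
rewrite derivation_det ?ev_gram // D_gram /mxtrace big1 // => i _.
have TT : (T + T^T) i i = 0 by rewrite mxE [T^T _ _]mxE T_low // addr0.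
by rewrite mul_mx_diag mxE mul_diag_mx mxE TT mulr0 mul0r.
Qed.

Let ev_det_gram j : ev (\det (flag_gram b X j)) = 1.
Proof. by rewrite -det_map_mx ev_gram det1. Qed.

Let ev_adj_gram j : map_mx ev (\adj (flag_gram b X j)) = 1%:M.
Proof.
rewrite map_mx_adj ev_gram; have := mul_mx_adj (1%:M : 'M[K]_n).
by rewrite mul1mx det1.
Qed.

Let D_adj_gram j : map_mx D (\adj (flag_gram b X j)) = - (E j *m (T + T^T) *m E j).
Proof.
have := congr1 (map_mx D) (mul_mx_adj (flag_gram b X j)).
rewrite derivation_mulmx ev_gram ev_adj_gram D_gram mulmx1 mul1mx.
rewrite derivation_scalar_mx // => /eqP; rewrite addrC addr_eq0 => /eqP.
by [].
Qed.

Let ev_flag_num j : map_mx ev (flag_num b X j) = E j.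
Proof.
rewrite /flag_num map_mxZ !map_mxM /= ev_adj_gram -map_trmx X1 map_trunc_mx.
rewrite trmx1 !mulmx1 mul1mx trunc_mxM //.
have [|-> _] := @derivation_prod1 _ (index_enum 'I_m.+1) (fun i => i != j :> nat)
  (fun i : 'I_m.+1 => \det (flag_gram b X i)); first by move=> i _; apply: ev_det_gram.
by rewrite scale1r.
Qed.

(** First-order change of a projection: the Gram term cancels the block cut out by [E j], leaving
    the blocks that mix the j-th step with its complement. *)
Let D_flag_num j : map_mx D (flag_num b X j) =
  T *m E j - E j *m (T + T^T) *m E j + E j *m T^T.
Proof.
rewrite /flag_num derivation_scalemx.
have [|-> ->] := @derivation_prod1 _ (index_enum 'I_m.+1) (fun i => i != j :> nat)
  (fun i : 'I_m.+1 => \det (flag_gram b X i)); first by move=> i _; apply: ev_det_gram.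
rewrite big1 => [|i _]; last exact: D_det_gram.
rewrite scale0r add0r scale1r !derivation_mulmx !map_mxM /= ev_adj_gram.
rewrite D_adj_gram -!map_trmx X1 !map_trunc_mx derivation_trunc_mx trmx1 -/T.
rewrite !(mulmx0, mul0mx, addr0, add0r, mulmx1, mul1mx).
move: (T + T^T) => M; rewrite trunc_mxM // mulmxDl -(mulmxA T) trunc_mxM //.
rewrite mulmxN mulNmx !mulmxA trunc_mxM //.
by rewrite -(mulmxA (E j *m M)) trunc_mxM.
Qed.

Lemma telescope_trunc (f : 'I_m -> K) (x : 'I_m) :
  \sum_(j < m) f j * ((x < j.+1)%N%:R - (x < j)%N%:R) = f x.
Proof.
rewrite (bigD1 x) //= big1 => [|j jx].
  by rewrite ltnSn ltnn subr0 mulr1 addr0.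
by rewrite ltnS leq_eqVlt val_eqE eq_sym (negbTE jx) subrr mulr0.
Qed.

(** As for the commutator of [T] with a diagonal matrix, an entry between two blocks varies by a
    difference of eigenvalues times an entry of [T]; on the diagonal only [mu] varies. *)
Lemma derivation_flag_mx k i : (b k <= b i)%N ->
  D (flag_mx b X mu k i) =
  D (mu (b k)) *+ (k == i) + (ev (mu (b k)) - ev (mu (b i))) * T i k.
Proof.
move=> ki.
have evN j : ev (flag_num b X j k i) = (b k < j)%N%:R *+ (k == i).
  transitivity (map_mx ev (flag_num b X j) k i); first by rewrite [RHS]mxE.
  by rewrite ev_flag_num trunc_mxE; case: eqP => [->|_]; rewrite ?andbT ?andbF.
have DN j : D (flag_num b X j k i) = ((b k < j)%N%:R - (b i < j)%N%:R) * T i k.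
  transitivity (map_mx D (flag_num b X j) k i); first by rewrite [RHS]mxE.
  have sumE (M1 M2 M3 : 'M[K]_n) : (M1 - M2 + M3) k i = M1 k i - M2 k i + M3 k i.
    by rewrite !mxE.
  have ME (M : 'M[K]_n) : (M *m E j) k i = M k i * (b i < j)%N%:R.
    by rewrite mul_mx_diag !mxE.
  have EM (M : 'M[K]_n) : (E j *m M) k i = (b k < j)%N%:R * M k i.
    by rewrite mul_diag_mx !mxE.
  have TT : (T + T^T) k i = T i k by rewrite mxE [T^T k i]mxE (T_low ki) add0r.
  rewrite D_flag_num sumE !ME !EM TT (T_low ki) [T^T k i]mxE mul0r add0r.
  have [ij|_] := ltnP (b i) j; last by rewrite mulr0n mulr0 oppr0 add0r addr0.
  by rewrite (leq_ltn_trans ki ij) !mul1r mulr1 addNr subrr mul0r.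
rewrite /flag_mx summxE raddf_sum /=.
transitivity (\sum_(j < m)
  ((D (mu j) *+ (k == i)) * ((b k < j.+1)%N%:R - (b k < j)%N%:R) +
   (ev (mu j) * ((b k < j.+1)%N%:R - (b k < j)%N%:R) -
    ev (mu j) * ((b i < j.+1)%N%:R - (b i < j)%N%:R)) * T i k)).
  apply: eq_bigr => j _.
  have -> : (mu j *: (flag_num b X j.+1 - flag_num b X j)) k i =
      mu j * (flag_num b X j.+1 k i - flag_num b X j k i) by rewrite !mxE.
  rewrite DM rmorphB raddfB /= !evN !DN -mulrBl mulrA -mulrnBl mulrnAr mulrnAl.
  congr (_ + _ * _); rewrite -mulrBr; congr (_ * _).
  by rewrite !opprB addrACA [in RHS]addrACA; congr (_ + _); rewrite addrC.
by rewrite big_split /= (telescope_trunc (fun j => D (mu j) *+ (k == i)))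
  -mulr_suml sumrB !telescope_trunc.
Qed.

End FlagDerivative.

(** * The chart *)

Section Chart.
Variables (n m : nat) (b : 'I_n -> 'I_m).
Local Notation d := #|{: param b}|.

Definition chart_base (A : comNzRingType) (y : param b -> A) : 'M[A]_n :=
  \matrix_(i, k)
    if (insub (inr (i, k)) : option (param b)) is Some t then y t else (i == k)%:R.

Definition chart_mx (A : comNzRingType) (y : param b -> A) : 'M[A]_n :=
  flag_mx b (chart_base y) (y \o mu_param b).

Lemma chart_base_unitriangular (A : comNzRingType) (y : param b -> A) i k :
  (b i <= b k)%N -> chart_base y i k = (i == k)%:R.
Proof. by move=> ik; rewrite mxE insubN //= -leqNgt. Qed.

Lemma map_chart_mx (A B : comNzRingType) (f : {rmorphism A -> B}) (y : param b -> A) :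
  map_mx f (chart_mx y) = chart_mx (f \o y).
Proof.
rewrite map_flag_mx; congr (flag_mx b _ _); apply/matrixP => i k.
by rewrite !mxE; case: insub => [t //|]; rewrite rmorph_nat.
Qed.

Lemma chart_mx_surj (A : comNzRingType) (Z : 'M[A]_n) mu :
  (forall i k, (b i <= b k)%N -> Z i k = (i == k)%:R) ->
  exists y, flag_mx b Z mu = chart_mx y.
Proof.
move=> Z1; exists (fun t => match val t with inl j => mu j | inr (i, k) => Z i k end).
rewrite /chart_mx; congr (flag_mx b _ _); apply/matrixP => i k.
rewrite mxE; case: insubP => [t _ -> //|]; rewrite /= -leqNgt.
exact: Z1.
Qed.

Definition chart_tuple (K : fieldType) : (sym_dim n).-tuple {mpoly K[d]} :=
  [tuple chart_mx (fun t => 'X_(enum_rank t) : {mpoly K[d]})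
     (enum_val k).1 (enum_val k).2 | k < sym_dim n].

Lemma pmap_chart (K : numFieldType) (v : 'I_d -> K) :
  pmap_point (chart_tuple K) v = sym_coord (chart_mx (v \o enum_rank)).
Proof.
apply/rowP => k; rewrite !mxE tnth_mktuple.
have -> : chart_mx (v \o enum_rank) =
    map_mx (meval v) (chart_mx (fun t => 'X_(enum_rank t) : {mpoly K[d]})).
  rewrite map_chart_mx; congr chart_mx; apply/funext => t /=.
  by rewrite mevalXU.
by rewrite mxE.
Qed.

Section ChartJacobian.
Variables (K : numFieldType) (r : 'I_m -> 'I_n).
Hypothesis b_mono : forall i k : 'I_n, (i <= k)%N -> (b i <= b k)%N.
Hypothesis bK : cancel r b.

(** The matrix entry that detects the parameter [t]. An eigenvalue is read on the diagonal inside
    its block; a chart entry is read at the transposed position, as only the upper triangle has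
    coordinates. *)
Definition sel_pair (t : param b) : 'I_n * 'I_n :=
  match val t with inl j => (r j, r j) | inr (i, k) => (k, i) end.

Lemma sel_pairP t : sel_pair t \in upper_pairs n.
Proof.
case: t => -[j|[i k]] tP; rewrite inE /sel_pair /=; first exact: leqnn.
by rewrite leqNgt; apply: contraL tP => /ltnW /b_mono; rewrite /= -leqNgt.
Qed.

Definition sel (a : 'I_d) : 'I_(sym_dim n) :=
  enum_rank_in (sel_pairP (enum_val a)) (sel_pair (enum_val a)).

Definition base_point (a : 'I_d) : K :=
  if val (enum_val a) is inl j then (j : nat)%:R else 0.

Definition jac_coef (a : 'I_d) : K :=
  if val (enum_val a) is inr (i, k) then (b k : nat)%:R - (b i : nat)%:R else 1.

Lemma jac_coef_neq0 a : jac_coef a != 0.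
Proof.
rewrite /jac_coef; case: (enum_val a) => -[j|[i k]] /= ki; first exact: oner_neq0.
by rewrite subr_eq0 eqr_nat ltn_eqF.
Qed.

Lemma chart_jacobian a c :
  ((tnth (chart_tuple K) (sel c))^`M(a)).@[base_point] = jac_coef c *+ (a == c).
Proof.
rewrite tnth_mktuple enum_rankK_in ?sel_pairP //.
pose y t : {mpoly K[d]} := 'X_(enum_rank t).
pose D : {additive {mpoly K[d]} -> K} := meval base_point \o mderiv a.
have DM p q : D (p * q) = D p * meval base_point q + meval base_point p * D q.
  by rewrite /D /= mderivM mevalD !mevalM.
have Dy t : D (y t) = (enum_rank t == a)%:R by rewrite /D /= mderivXU rmorph_nat.
have evy t : meval base_point (y t) = if sval t is inl j then (j : nat)%:R else 0.
  by rewrite mevalXU /base_point enum_rankK.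
have X1 : map_mx (meval base_point) (chart_base y) = 1%:M.
  apply/matrixP => i k; rewrite !mxE.
  case: insubP => [t|_ /=]; last by rewrite rmorph_nat.
  move=> /= ki tE; rewrite evy tE; case: eqP => // ik.
  by rewrite ik ltnn in ki.
have T_low i k : (b i <= b k)%N -> map_mx D (chart_base y) i k = 0.
  move=> ik; rewrite mxE chart_base_unitriangular //.
  exact: derivation_nat DM _.
have mainE := derivation_flag_mx DM (y \o mu_param b) X1 T_low.
rewrite -[LHS]/(D (chart_mx y (sel_pair (enum_val c)).1 (sel_pair (enum_val c)).2)).
clearbody D; rewrite /sel_pair /jac_coef; case E: (val (enum_val c)) => [j|[i k]] /=.
  rewrite [LHS](mainE _ _ (leqnn _)) /= subrr mul0r addr0 eqxx bK Dy eq_sym.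
  have -> : mu_param b j = enum_val c by apply: val_inj; rewrite E.
  by rewrite enum_valK.
have ki : (b k < b i)%N by have := valP (enum_val c); rewrite E.
have -> : D (chart_mx y k i) = ((b k : nat)%:R - (b i : nat)%:R) * D (y (enum_val c)).
  rewrite [LHS](mainE _ _ (ltnW ki)) /=.
  case: eqP => [ik|_]; first by rewrite ik ltnn in ki.
  rewrite add0r !evy /= mxE; congr (_ * D _); rewrite mxE.
  case: insubP => [t _ tE|]; last by rewrite /= ki.
  by congr y; apply: val_inj; rewrite E.
by rewrite Dy enum_valK mulr_natr eq_sym.
Qed.

End ChartJacobian.
End Chart.

(** * Parametrization of the real and the complex variety *)

Section Main.
Variables (R : realType) (n : nat) (lam : seq nat).
Hypothesis lamn : sumn lam = n.
Hypothesis lam_pos : all (fun l => 0 < l)%N lam.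
Local Notation b := (block_of lamn).
Local Notation d := #|{: param b}|.

(** Multiplying [p] by the product of the differences of the eigenvalue coordinates gives a
    polynomial vanishing everywhere. *)
Lemma chart_distinct_dense (p : {mpoly R[d]}) :
  (forall v : 'I_d -> R, injective (fun j => v (enum_rank (mu_param b j))) ->
    p.@[v] = 0) -> p = 0.
Proof.
move=> hp; pose X j : {mpoly R[d]} := 'X_(enum_rank (mu_param b j)).
pose disc := \prod_(q : 'I_(size lam) * 'I_(size lam) | q.1 != q.2) (X q.1 - X q.2).
have disc0 : disc != 0.
  apply/prodf_neq0 => -[i j] /= ij; apply: contra_neqN ij => /eqP.
  move/(congr1 (mcoeff U_(enum_rank (mu_param b i)))).
  rewrite mcoeffB !mcoeffXU eqxx mcoeff0 => /eqP; rewrite subr_eq0.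
  rewrite eqr_nat; have [E _|//] := eqVneq (enum_rank (mu_param b j)) _.
  by have [->] := congr1 val (enum_rank_inj E).
apply/eqP; have := mulf_eq0 p disc; rewrite (negbTE disc0) orbF => <-.
apply/eqP/mpoly_zeros => v; rewrite mevalM.
have [inj_v|ninj] := pselect (injective (fun j => v (enum_rank (mu_param b j)))).
  by rewrite hp ?mul0r.
have [i [j [vij ij]]] : exists i j, v (enum_rank (mu_param b i)) =
    v (enum_rank (mu_param b j)) /\ i != j.
  apply: contrapT => H; apply: ninj => i j vij; apply/eqP; apply: contrapT => /negP ij.
  by apply: H; exists i, j.
by rewrite rmorph_prod (bigD1 (i, j)) //= mevalB !mevalXU vij subrr mul0r mulr0.
Qed.

Lemma parametrized_VR : parametrized (chart_tuple b R) (VR R n lam).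
Proof.
split; first exact: zariski_closure_closed.
move=> p; split=> [/vanishing_closure hp|pg0].
  apply: chart_distinct_dense => v inj_v.
  rewrite -peval_pmap_point pmap_chart; apply: hp; eexists; last by [].
  have Zu := unitriangular_unit (block_of_mono lamn)
    (fun i k => @chart_base_unitriangular _ _ b _ (v \o enum_rank) i k).
  split; first exact: tr_flag_mx.
  exact: has_multiplicities_flag_mx.
apply/vanishing_closure => _ [A [As mA] <-].
have [X Xu [mu ->]] := symmetric_has_multiplicities lamn As mA.
apply: (chart_dense (block_of_mono lamn)) => // Z nu /chart_mx_surj-/(_ nu)[y ->].
have -> : y = (y \o enum_val) \o enum_rank by apply/funext => t /=; rewrite enum_rankK.
by rewrite -pmap_chart peval_pmap_point pg0 meval0.
Qed.

(** Real points are dense in the complex parameter space, so the same chart parametrizes the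
    complexification. *)
Lemma parametrized_VC : parametrized (chart_tuple b (R[i] : numFieldType)) (VC R n lam).
Proof.
pose W := range (pmap_point (chart_tuple b R)).
have [_ VRp] := parametrized_VR.
have vanishE : vanishing (VR R n lam) = vanishing W.
  apply/seteqP; split=> p.
    by move=> /VRp pg0 _ [v _ <-]; rewrite peval_pmap_point pg0 meval0.
  move=> hp; apply/VRp/mpoly_zeros => v; rewrite -peval_pmap_point; apply: hp.
  by exists v.
(* The complexification depends only on the real vanishing ideal, so [VR] can be replaced by the
   image of the chart. *)
rewrite /VC complexificationE vanishE -complexificationE /complexification.
pose f := real_complex R.
have map_point u : map_mx f (pmap_point (chart_tuple b R) u) =
    pmap_point (chart_tuple b (R[i] : numFieldType)) (f \o u).
  rewrite !pmap_chart -[_ \o enum_rank in RHS]/(f \o (u \o enum_rank)) -map_chart_mx.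
  by apply/rowP => k; rewrite !mxE.
pose S := [set v : 'I_d -> R[i] | exists u, v = f \o u].
have -> : [set map_mx f x | x in W] =
    [set pmap_point (chart_tuple b (R[i] : numFieldType)) v | v in S].
  apply/seteqP; split=> [_ [_ [u _ <-] <-]|_ [_ [u ->] <-]].
    by exists (f \o u); [exists u | rewrite map_point].
  by exists (pmap_point (chart_tuple b R) u); [exists u | rewrite map_point].
apply: parametrized_closure => p hp; apply: mpoly_nat_zeros => v.
apply: hp; exists (fun k => (v k)%:R).
by apply/funext => k; apply: esym (rmorph_nat (real_complex R) (v k)).
Qed.

Lemma card_param_block :
  d = (size lam + 'C(n, 2) - \sum_(l <- lam) 'C(l, 2))%N.
Proof.
rewrite card_param (big_nth 0%N) big_mkord; congr (_ - _)%N.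
by apply: eq_bigr => j _; rewrite card_block_of.
Qed.

End Main.

Theorem theorem3p1 (R : realType) (n : nat) (lam : seq nat)
    (hlam : is_partition n lam) :
  irreducible_variety (VC R n lam) /\
  has_dimension (VC R n lam)
    (size lam + 'C(n, 2) - \sum_(l <- lam) 'C(l, 2))%N.
Proof.
have [_ pos lamn] := hlam; have VCp := parametrized_VC R lamn pos.
split; first exact: parametrized_irreducible VCp.
rewrite -(card_param_block lamn); split; last first.
  by move=> e F; apply: parametrized_chain_le VCp.
(* [r] picks an index in each block, which is nonempty because the parts are positive. *)
have [r br] : exists r, cancel r (block_of lamn).
  by have [r] := choice (block_of_surj lamn pos); exists r.
exact: (parametrized_chain VCp (@jac_coef_neq0 _ _ _ _)
  (chart_jacobian _ (block_of_mono lamn) br)).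
Qed.
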